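(* Let $0<a<b<\infty$. There exist constants $c_1,c_2>0$, depending only on $a,b$, such that for all nonzero real-valued $f\in H^2[0,\infty]$ $$\|\mathcal{L}_{a,b}^*f\|_{L^2[a,b]}\;\geq\; c_1\exp\left(-c_2\frac{\|xf_{xx}\|_{L^2[0,\infty]}+\|xf_x\|_{L^2[0,\infty]}+\|xf\|_{L^2[0,\infty]}+\|f\|_{L^2[0,\infty]}}{\|f\|_{L^2[0,\infty]}}\right)\|f\|_{L^2[0,\infty]}.$$
   Context: For $0<a<b<\infty$, the adjoint truncated Laplace transform $\mathcal{L}_{a,b}^*:L^2[0,\infty]\to L^2[a,b]$ is defined by $(\mathcal{L}_{a,b}^*f)(s)=\int_0^\infty e^{-st}f(t)\,dt$ for $s\in[a,b]$. Here $L^2[0,\infty]$ and $H^2[0,\infty]$ denote the usual $L^2$ and Sobolev spaces on the half-line $[0,\infty)$; $f_x,f_{xx}$ are the first and second (weak) derivatives of $f$; and $xf_{xx}$, $xf_x$, $xf$ denote the functions $x\mapsto x f_{xx}(x)$, $x\mapsto xf_x(x)$, $x\mapsto xf(x)$. If one of the weighted norms is infinite, the right-hand side of the inequality is read as $0$ (that is, $\exp(-\infty)=0$). *)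

(* Defs.v *)
From HB Require Import structures.
From mathcomp Require Import all_boot all_order all_algebra.
From mathcomp Require Import all_classical all_reals all_analysis.
Set Implicit Arguments.
Unset Strict Implicit.
Unset Printing Implicit Defensive.
Import Order.TTheory GRing.Theory Num.Theory.
Import numFieldNormedType.Exports.
Local Open Scope classical_set_scope.
Local Open Scope ring_scope.

Section Defs.
Context {R : realType}.
Implicit Types (D : set R) (f g phi : R -> R) (s : R).

Local Notation mu := (@lebesgue_measure R).

(* A function on D is represented by some f : R -> R whose values outside D
   are irrelevant: f is replaced by 0 there. *)
Definition inL2 D f : Prop := f \_ D \in Lfun mu 2%:E.

Definition L2norm D f : \bar R := ('N[mu]_2%:E [EFin \o (f \_ D)])%E.

(* phi \in C_c^oo(0, +oo): the support stays away from 0. *)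
Definition test_function phi : Prop :=
  (forall (n : nat) (x : R), derivable (derive1n n phi) x 1) /\
  exists c d : R, 0 < c /\ forall x : R, ~ (c <= x <= d) -> phi x = 0.

(* g is the weak derivative of f in the open half-line. *)
Definition weak_derivative f g : Prop :=
  [/\ locally_integrable `]0, +oo[ f, locally_integrable `]0, +oo[ g &
   forall phi, test_function phi ->
     \int[mu]_(x in `]0, +oo[) (f x * derive1 phi x) =
     - \int[mu]_(x in `]0, +oo[) (g x * phi x)].

(* f belongs to H^2 of the half-line, with f_x = fx and f_xx = fxx; these are
   determined by f up to a null set, so quantifying over (f, fx, fxx) amounts
   to quantifying over the Sobolev space. *)
Definition inH2 (f fx fxx : R -> R) : Prop :=
  [/\ inL2 `[0, +oo[ f, inL2 `[0, +oo[ fx, inL2 `[0, +oo[ fxx,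
      weak_derivative f fx & weak_derivative fx fxx].

Definition laplace_adj f s : R :=
  \int[mu]_(t in `[0, +oo[) (expR (- (s * t)) * f t).

End Defs.

(* Main.v *)
Require Import Defs.
From HB Require Import structures.
From mathcomp Require Import all_boot all_order all_algebra.
From mathcomp Require Import all_classical all_reals all_analysis.
From mathcomp Require Import measurable_realfun qpoly zify ring lra.
Set Implicit Arguments.
Unset Strict Implicit.
Unset Printing Implicit Defensive.
Import Order.TTheory GRing.Theory Num.Theory.
Import numFieldNormedType.Exports.
Local Open Scope classical_set_scope.
Local Open Scope ring_scope.

(** Let F be the Laplace transform of f. The theorem holds because f is concentrated on its first
    N Laguerre coefficients, with N proportional to the quotient in the exponent, and because N
    Laguerre coefficients can be recovered from F on [a, b] with a loss that is only exponential
    in N.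

    Let l_n(x) = L_n(2 a x) e^(-a x), an orthogonal family with squared norms 1 / (2 a), and let
    c_n be the inner product of f and l_n.

    Concentration. The l_n are eigenfunctions of u |-> x u'' + u' - a^2 x u with eigenvalues
    - 2 a (n + 1/2). Integration by parts (weak_integration_by_parts), free of boundary terms
    because x vanishes at 0, gives
    2 a (n + 1/2) c_n = a^2 <x f, l_n> - <f', l_n> - <x f'', l_n>.
    The middle term is controlled by x f'' through a Hardy inequality, proved on the side of the
    coefficients (l2_hardy). Thus the sum of n^2 c_n^2 is at most a multiple of
    (|x f| + |x f''|)^2 (laguerre_coef_decay). As the l_n are complete (laguerre_complete), the
    coefficients of index n < N carry half of the squared norm of f as soon as N exceeds a
    multiple of (|x f| + |x f''| + |f|) / |f| (laguerre_concentration).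

    Completeness. The coefficients of e^(-s x) are z^n / (s + a) with z = (s - a) / (s + a), so
    that Parseval's identity for e^(-s x) is a geometric series. Combinations of exponentials are
    dense in L^2 by the Weierstrass theorem in the variable u = e^(-x).

    Recovery. The same formula shows that (s + a) F(s) / (2 a) is the power series with
    coefficients c_n at z. Cut it at degree K and interpolate it at K + 1 separated nodes
    in [0, t], chosen such that F at these nodes does not exceed its mean over short intervals:
    |c_n| t^n is at most C^K (|F| + t^(K+1) |f|) with C independent of t
    (laguerre_coef_node_bound). Take K = 4 N. For n < N, dividing by t^n leaves the truncation
    error C^(4 N) t^(3 N) |f|, which is absorbed when t is small. What remains is
    |F| >= c q^N |f| with q < 1 (laplace_lower_bound). *)

(** * The inner product of the half-line *)

Section HalfLineL2.
Context {R : realType}.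
Implicit Types (f g h : R -> R).
Local Notation mu := (@lebesgue_measure R).
Local Notation D := (`]0, +oo[%classic : set R).

(** The condition is on the open half-line only, so that x > 0 may be used pointwise; the values
    at x <= 0 are irrelevant. *)
Definition L2 f := measurable_fun D f /\ mu.-integrable D (EFin \o (fun x => f x ^+ 2)).

Definition ip f g : R := \int[mu]_(x in D) (f x * g x).

Lemma measurable_D : measurable D. Proof. exact: measurable_itv. Qed.
Hint Resolve measurable_D : core.

Lemma le_integrableR E f g : measurable E -> measurable_fun E f ->
  (forall x, E x -> `|f x| <= g x) -> mu.-integrable E (EFin \o g) ->
  mu.-integrable E (EFin \o f).
Proof.
move=> mE mf fg; apply: le_integrable => //; first exact/measurable_EFinP.
by move=> x Ex /=; rewrite lee_fin (le_trans (fg x Ex)) ?ler_norm.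
Qed.

(** |f g| <= f^2 + g^2. *)
Lemma integrable_mul f g : L2 f -> L2 g -> mu.-integrable D (EFin \o (fun x => f x * g x)).
Proof.
move=> [mf i_f] [mg ig].
apply: (@le_integrableR _ _ (fun x => f x ^+ 2 + g x ^+ 2)) => //.
- exact: measurable_funM.
- move=> x _; rewrite normrM.
  have := sqr_ge0 (`|f x| - `|g x|); rewrite sqrrB !real_normK ?num_real//.
  have : 0 <= `|f x| * `|g x| by rewrite mulr_ge0.
  by rewrite mulr2n; lra.
- exact: (@integrableD _ _ _ mu D measurable_D (EFin \o (fun x => f x ^+ 2))
    (EFin \o (fun x => g x ^+ 2))).
Qed.

Lemma L2D f g : L2 f -> L2 g -> L2 (fun x => f x + g x).
Proof.
move=> [mf i_f] [mg ig]; split; first exact: measurable_funD.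
apply: (@le_integrableR _ _ (fun x => (2 * f x ^+ 2) + (2 * g x ^+ 2))) => //.
- by apply: measurable_funX; exact: measurable_funD.
- move=> x _; rewrite ger0_norm ?sqr_ge0//.
  by have := sqr_ge0 (f x - g x); rewrite !expr2; nra.
- apply: (@integrableD _ _ _ mu D measurable_D (EFin \o (fun x => 2 * f x ^+ 2))
    (EFin \o (fun x => 2 * g x ^+ 2))).
  + exact: (@integrableZl _ _ _ mu D measurable_D _ (EFin \o (fun x => f x ^+ 2))).
  + exact: (@integrableZl _ _ _ mu D measurable_D _ (EFin \o (fun x => g x ^+ 2))).
Qed.

Lemma L2Z k f : L2 f -> L2 (fun x => k * f x).
Proof.
move=> [mf i_f]; split; first by apply: measurable_funM.
rewrite (_ : (fun x => (k * f x) ^+ 2) = (fun x => k ^+ 2 * f x ^+ 2)).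
  exact: (@integrableZl _ _ _ mu D measurable_D _ (EFin \o (fun x => f x ^+ 2))).
by apply/funext => x; rewrite exprMn.
Qed.

Lemma L2B f g : L2 f -> L2 g -> L2 (fun x => f x - g x).
Proof.
move=> hf hg; rewrite (_ : (fun x => _) = (fun x => f x + (-1) * g x)).
  by apply: L2D => //; exact: L2Z.
by apply/funext => x; rewrite mulN1r.
Qed.

Lemma L2_0 : L2 (fun=> 0).
Proof.
split => //; rewrite (_ : _ \o _ = cst 0%E); first exact: integrable0.
by apply/funext => x /=; rewrite expr0n.
Qed.

Lemma L2_sum n (F : nat -> R -> R) : (forall i, L2 (F i)) ->
  L2 (fun x => \sum_(i < n) F i x).
Proof.
move=> hF; elim: n => [|n IH].
  by under eq_fun do rewrite big_ord0; exact: L2_0.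
by under eq_fun do rewrite big_ord_recr/=; exact: L2D.
Qed.

Lemma L2_le f g : measurable_fun D f -> L2 g -> (forall x, 0 < x -> `|f x| <= `|g x|) -> L2 f.
Proof.
move=> mf [mg ig] fg; split => //.
apply: (@le_integrableR _ _ (fun x => g x ^+ 2)) => //; first exact: measurable_funX.
move=> x /=; rewrite in_itv/= andbT => x0; rewrite ger0_norm ?sqr_ge0//.
by rewrite -(real_normK (num_real (f x))) -(real_normK (num_real (g x))) lerXn2r ?nnegrE// fg.
Qed.

Lemma ipC f g : ip f g = ip g f.
Proof. by apply: eq_Rintegral => x _; rewrite mulrC. Qed.

Lemma eq_ip f g f' g' : (forall x, 0 < x -> f x * g x = f' x * g' x) -> ip f g = ip f' g'.
Proof.
by move=> h; apply: eq_Rintegral => x; rewrite inE/= in_itv/= andbT; exact: h.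
Qed.

Lemma ipDl f g h : L2 f -> L2 g -> L2 h -> ip (fun x => f x + g x) h = ip f h + ip g h.
Proof.
move=> hf hg hh; rewrite /ip -RintegralD//; [|exact: integrable_mul..].
by apply: eq_Rintegral => x _; rewrite mulrDl.
Qed.

Lemma ipZl k f g : L2 f -> L2 g -> ip (fun x => k * f x) g = k * ip f g.
Proof.
move=> hf hg; rewrite /ip -RintegralZl//; last exact: integrable_mul.
by apply: eq_Rintegral => x _; rewrite mulrA.
Qed.

Lemma ipBl f g h : L2 f -> L2 g -> L2 h -> ip (fun x => f x - g x) h = ip f h - ip g h.
Proof.
move=> hf hg hh; rewrite /ip -RintegralB//; [|exact: integrable_mul..].
by apply: eq_Rintegral => x _; rewrite mulrBl.
Qed.

Lemma ip0l g : ip (fun=> 0) g = 0.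
Proof.
rewrite /ip; under eq_Rintegral do rewrite mul0r.
by rewrite /Rintegral integral0.
Qed.

Lemma ip_suml n (F : nat -> R -> R) g : (forall i, L2 (F i)) -> L2 g ->
  ip (fun x => \sum_(i < n) F i x) g = \sum_(i < n) ip (F i) g.
Proof.
move=> hF hg; elim: n => [|n IH].
  by under eq_fun do rewrite big_ord0; rewrite ip0l big_ord0.
under eq_fun do rewrite big_ord_recr/=.
by rewrite ipDl// ?IH ?big_ord_recr//; exact: L2_sum.
Qed.

Lemma ip_ge0 f : 0 <= ip f f.
Proof. by apply: Rintegral_ge0 => x _; rewrite -expr2 sqr_ge0. Qed.

Lemma ipDr f g h : L2 f -> L2 g -> L2 h -> ip h (fun x => f x + g x) = ip h f + ip h g.
Proof. by move=> hf hg hh; rewrite ipC ipDl// !(ipC h). Qed.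

Lemma ipBr f g h : L2 f -> L2 g -> L2 h -> ip h (fun x => f x - g x) = ip h f - ip h g.
Proof. by move=> hf hg hh; rewrite ipC ipBl// !(ipC h). Qed.

Lemma ipZr k f g : L2 f -> L2 g -> ip g (fun x => k * f x) = k * ip g f.
Proof. by move=> hf hg; rewrite ipC ipZl// (ipC g). Qed.

Lemma ip_sub_sqr f g : L2 f -> L2 g ->
  ip (fun x => f x - g x) (fun x => f x - g x) = ip f f - 2 * ip f g + ip g g.
Proof.
move=> hf hg; have hb := L2B hf hg.
by rewrite ipBl// !ipBr// (ipC g f); ring.
Qed.

Lemma ip_add_sqr f g : L2 f -> L2 g ->
  ip (fun x => f x + g x) (fun x => f x + g x) = ip f f + 2 * ip f g + ip g g.
Proof.
move=> hf hg; have hb := L2D hf hg.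
by rewrite ipDl// !ipDr// (ipC g f); ring.
Qed.

(** Expand 0 <= <f - t g, f - t g> and choose t. *)
Lemma cauchy_schwarz f g : L2 f -> L2 g -> ip f g ^+ 2 <= ip f f * ip g g.
Proof.
move=> hf hg.
have H t : 0 <= ip f f - 2 * t * ip f g + t ^+ 2 * ip g g.
  have := ip_ge0 (fun x => f x - t * g x).
  have hZ := L2Z t hg.
  rewrite ip_sub_sqr// ipZl// !ipZr//.
  by congr (0 <= _); ring.
have [g0|gn0] := eqVneq (ip g g) 0.
  have [->|fg0] := eqVneq (ip f g) 0; first by rewrite g0 mulr0 expr0n.
(* a value of t at which the expression, now affine in t, equals -1 *)
  have := H ((ip f f + 1) / (2 * ip f g)); rewrite g0 mulr0 addr0.
  have -> : 2 * ((ip f f + 1) / (2 * ip f g)) * ip f g = ip f f + 1 by field.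
  by lra.
have gp : 0 < ip g g by rewrite lt0r gn0 ip_ge0.
have := H (ip f g / ip g g).
have -> : ip f f - 2 * (ip f g / ip g g) * ip f g + (ip f g / ip g g) ^+ 2 * ip g g
  = (ip f f * ip g g - ip f g ^+ 2) / ip g g by field.
by rewrite pmulr_lge0 ?invr_gt0// subr_ge0.
Qed.

Lemma ip_le f g : L2 f -> L2 g -> (forall x, 0 < x -> `|f x| <= `|g x|) -> ip f f <= ip g g.
Proof.
move=> hf hg fg; apply: le_Rintegral => //; [exact: integrable_mul..|].
move=> x /=; rewrite in_itv/= andbT => x0; rewrite -!expr2.
by rewrite -(real_normK (num_real (f x))) -(real_normK (num_real (g x))) lerXn2r ?nnegrE// fg.
Qed.

End HalfLineL2.
#[global] Hint Resolve measurable_D : core.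

(** * Polynomials times exponentials *)

Section ExponentialPolynomials.
Context {R : realType}.
Implicit Types (p q : {poly R}) (c s x : R).
Local Notation mu := (@lebesgue_measure R).
Local Notation D := (`]0, +oo[%classic : set R).

Definition exp_poly c p x : R := p.[x] * expR (- (c * x)).

(** The Laplace transform of p at c, see integral_exp_poly. *)
Definition laplace_poly c p : R := \sum_(k < size p) p`_k * k`!%:R / c ^+ k.+1.

Lemma laplace_polyE c p n : (size p <= n)%N ->
  laplace_poly c p = \sum_(k < n) p`_k * k`!%:R / c ^+ k.+1.
Proof.
move=> pn; rewrite /laplace_poly (big_ord_widen n (fun k => p`_k * k`!%:R / c ^+ k.+1))//.
rewrite big_mkcond/=; apply: eq_bigr => i _; case: ifPn => //.
by rewrite -leqNgt => pi; rewrite nth_default ?mul0r.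
Qed.

Lemma is_derive_exp_poly c p x : is_derive x 1 (exp_poly c p) (exp_poly c (p^`() - c *: p) x).
Proof.
have dl : is_derive x 1 (fun y : R => - (c * y)) (- c).
  have -> : (fun y : R => - (c * y)) = horner (- c *: 'X).
    by apply/funext => y; rewrite hornerZ hornerX mulNr.
  have := is_derive_poly (- c *: 'X) x.
  by rewrite derivZ derivX hornerZ hornerC mulr1.
have de := @is_derive1_comp _ expR (fun y => - (c * y)) x _ _ (is_derive_expR _) dl.
apply: (is_derive_eq (is_deriveM (is_derive_poly p x) de)).
rewrite /exp_poly hornerD hornerN hornerZ /= /GRing.scale/=; ring.
Qed.

Lemma continuous_exp_poly c p : continuous (exp_poly c p).
Proof.
move=> x; apply: differentiable_continuous; apply/derivable1_diffP.
by have [] := is_derive_exp_poly c p x.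
Qed.

Lemma measurable_exp_poly c p (E : set R) : measurable_fun E (exp_poly c p).
Proof. by apply: measurable_funTS; apply: continuous_measurable_fun; exact: continuous_exp_poly. Qed.

(** Squeeze: e^(c x) >= (c x)^(n+1) / (n+1)! leaves a bound of order 1 / x. *)
Lemma exp_monom_cvg0 c n : 0 < c -> exp_poly c 'X^n x @[x --> +oo] --> 0.
Proof.
move=> c0; pose M := n.+1`!%:R / c ^+ n.+1.
apply: (@squeeze_cvgr _ _ _ _ (fun=> 0) (fun x => M * x^-1)).
- near=> x; have x0 : 0 < x by near: x; exact: nbhs_pinfty_gt.
  rewrite /exp_poly hornerXn; apply/andP; split; first by rewrite mulr_ge0 ?exprn_ge0 ?expR_ge0 ?ltW.
  rewrite expRN ler_pdivrMr ?expR_gt0//.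
  have H := expR_ge1Dxn n (ltW (mulr_gt0 c0 x0)).
  have H2 : (c * x) ^+ n.+1 / n.+1`!%:R <= expR (c * x) by lra.
  have Mx : 0 <= M * x^-1 by rewrite /M !mulr_ge0 ?invr_ge0 ?exprn_ge0 ?ler0n ?ltW.
  apply: le_trans (ler_wpM2l Mx H2).
  rewrite [leRHS](_ : _ = x ^+ n)//.
  rewrite /M exprMn (exprS x); field; rewrite (gt_eqF x0) /= expf_neq0 ?gt_eqF//.
- exact: cvg_cst.
- rewrite -[X in _ --> X](mulr0 M); apply: cvgM; first exact: cvg_cst.
  apply/cvgrPdist_lt => e e0; near=> x.
  have xe : e^-1 < x by near: x; apply: nbhs_pinfty_gt; rewrite num_real.
  have x0 : 0 < x by rewrite (lt_trans _ xe) ?invr_gt0.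
  by rewrite sub0r normrN gtr0_norm ?invr_gt0// invf_plt ?posrE.
Unshelve. all: by end_near. Qed.

Lemma exp_poly_sum c p x : exp_poly c p x = \sum_(k < size p) p`_k * exp_poly c 'X^k x.
Proof.
rewrite /exp_poly horner_coef mulr_suml; apply: eq_bigr => i _.
by rewrite hornerXn mulrA.
Qed.

Lemma exp_poly_cvg0 c p : 0 < c -> exp_poly c p x @[x --> +oo] --> 0.
Proof.
move=> c0; under eq_fun do rewrite exp_poly_sum.
move: (size p) => n; elim: n => [|n IH].
  by under eq_fun do rewrite big_ord0; exact: cvg_cst.
under eq_fun do rewrite big_ord_recr/=.
have h : p`_n * exp_poly c 'X^n x @[x --> +oo] --> p`_n * 0.
  by apply: cvgM; [exact: cvg_cst|exact: exp_monom_cvg0].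
have := cvgD IH h; rewrite mulr0 addr0; exact.
Qed.

(** The polynomial q with c q - q' = 'X^k: then - q(x) e^(-c x) is a primitive of
    x^k e^(-c x), and q(0) is the integral of the latter over the half-line. *)
Fixpoint exp_primitive c k : {poly R} :=
  if k is j.+1 then c^-1 *: ('X^k + k%:R *: exp_primitive c j) else (c^-1)%:P.

Lemma exp_primitiveP c k : 0 < c -> c *: exp_primitive c k - (exp_primitive c k)^`() = 'X^k.
Proof.
move=> c0; have cn0 : c != 0 by rewrite gt_eqF.
elim: k => [|k IH] /=; first by rewrite derivC subr0 -mul_polyC -polyCM mulfV.
rewrite scalerA mulfV// scale1r derivZ derivD derivXn derivZ /=.
rewrite -(scaler_nat k.+1 'X^k) -scalerDr -IH.
by rewrite subrK !scalerA mulrAC mulVf// mul1r addrK.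
Qed.

Lemma exp_primitive0 c k : 0 < c -> (exp_primitive c k).[0] = k`!%:R / c ^+ k.+1.
Proof.
move=> c0; have cn0 : c != 0 by rewrite gt_eqF.
elim: k => [|k IH] /=; first by rewrite hornerC fact0 expr1 mul1r.
rewrite hornerZ hornerD hornerXn hornerZ IH expr0n /= add0r factS natrM (exprS _ k.+1).
by field; rewrite cn0 expf_neq0.
Qed.

Lemma integral_exp_monom c k : 0 < c ->
  (\int[mu]_(x in `[0%R, +oo[) (exp_poly c 'X^k x)%:E = (k`!%:R / c ^+ k.+1)%:E)%E.
Proof.
move=> c0.
have dF x : is_derive x 1 (fun x => - exp_poly c (exp_primitive c k) x) (exp_poly c 'X^k x).
  apply: (is_derive_eq (is_deriveN (is_derive_exp_poly c (exp_primitive c k) x))).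
  by rewrite -(exp_primitiveP k c0) /exp_poly !hornerD !hornerN; ring.
rewrite (@ge0_continuous_FTC2y _ (exp_poly c 'X^k) (fun x => - exp_poly c (exp_primitive c k) x) 0 0).
- by rewrite sub0e -EFinN opprK /exp_poly mulr0 oppr0 expR0 mulr1 exp_primitive0.
- by move=> x x0; rewrite /exp_poly hornerXn mulr_ge0 ?exprn_ge0 ?expR_ge0.
- exact/continuous_subspaceT/continuous_exp_poly.
- by rewrite -oppr0; apply: (@cvgN _ R^o); exact: exp_poly_cvg0.
- by move=> x _; have [] := dF x.
- by apply: cvg_at_right_filter; apply: (@cvgN _ R^o); exact: continuous_exp_poly.
- by move=> x _; rewrite derive1E; have [_ ->] := dF x.
Qed.

Lemma integrable_exp_monom c k : 0 < c -> mu.-integrable D (EFin \o exp_poly c 'X^k).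
Proof.
move=> c0; apply/integrableP; split.
  by apply/measurable_EFinP; exact: measurable_exp_poly.
have -> : (\int[mu]_(x in D) `|(EFin \o exp_poly c 'X^k) x| = \int[mu]_(x in D) (exp_poly c 'X^k x)%:E)%E.
  apply: eq_integral => x; rewrite inE/= in_itv/= andbT => x0.
  by rewrite ger0_norm// /exp_poly hornerXn mulr_ge0 ?exprn_ge0 ?expR_ge0// ltW.
rewrite integral_itv_obnd_cbnd ?integral_exp_monom ?ltry//.
by apply/measurable_EFinP; exact: measurable_exp_poly.
Qed.

Lemma Rintegral_exp_monom c k : 0 < c -> \int[mu]_(x in D) exp_poly c 'X^k x = k`!%:R / c ^+ k.+1.
Proof.
move=> c0; rewrite /Rintegral integral_itv_obnd_cbnd ?integral_exp_monom//.
by apply/measurable_EFinP; exact: measurable_exp_poly.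
Qed.

Lemma integral_exp_poly c p : 0 < c ->
  mu.-integrable D (EFin \o exp_poly c p) /\ \int[mu]_(x in D) exp_poly c p x = laplace_poly c p.
Proof.
move=> c0; have -> : exp_poly c p = (fun x => \sum_(k < size p) p`_k * exp_poly c 'X^k x).
  by apply/funext => x; exact: exp_poly_sum.
rewrite /laplace_poly; move: (size p) => n; elim: n => [|n [IHi IHe]].
  have -> : (fun x => \sum_(k < 0) p`_k * exp_poly c 'X^k x) = (fun=> 0).
    by apply/funext => x; rewrite big_ord0.
  split; first exact: integrable0.
  by rewrite big_ord0 /Rintegral integral0.
have iZ : mu.-integrable D (EFin \o (fun x => p`_n * exp_poly c 'X^n x)).
  exact: (@integrableZl _ _ _ mu D measurable_D _ (EFin \o exp_poly c 'X^n) (integrable_exp_monom n c0)).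
have -> : (fun x => \sum_(k < n.+1) p`_k * exp_poly c 'X^k x) =
    (fun x => \sum_(k < n) p`_k * exp_poly c 'X^k x + p`_n * exp_poly c 'X^n x).
  by apply/funext => x; rewrite big_ord_recr.
split.
  exact: (@integrableD _ _ _ mu D measurable_D (EFin \o _) (EFin \o _) IHi iZ).
rewrite RintegralD// IHe big_ord_recr/=; congr (_ + _).
by rewrite RintegralZl ?Rintegral_exp_monom ?mulrA//; exact: integrable_exp_monom.
Qed.

Lemma exp_polyM c s p q x : exp_poly c p x * exp_poly s q x = exp_poly (c + s) (p * q) x.
Proof. by rewrite /exp_poly hornerM mulrDl opprD expRD; ring. Qed.

Lemma L2_exp_poly c p : 0 < c -> L2 (exp_poly c p).
Proof.
move=> c0; split; first exact: measurable_exp_poly.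
have -> : (fun x => exp_poly c p x ^+ 2) = exp_poly (c + c) (p * p).
  by apply/funext => x; rewrite expr2 exp_polyM.
by apply: (integral_exp_poly _ _).1; rewrite addr_gt0.
Qed.

Lemma ip_exp_poly c s p q : 0 < c -> 0 < s -> ip (exp_poly c p) (exp_poly s q) = laplace_poly (c + s) (p * q).
Proof.
move=> c0 s0; rewrite -(integral_exp_poly (p * q) (addr_gt0 c0 s0)).2.
by apply: eq_Rintegral => x _; rewrite exp_polyM.
Qed.

End ExponentialPolynomials.

(** * Laguerre functions *)

Section LaguerreFunctions.
Context {R : realType}.
Implicit Types (a s x : R) (n m k : nat) (p : {poly R}).

(** The polynomial L_n(2 a x), where L_n is the n-th Laguerre polynomial. *)
Definition laguerre a n : {poly R} :=
  \poly_(k < n.+1) ('C(n, k)%:R * ((- (2 * a)) ^+ k / k`!%:R)).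

(** These functions are orthogonal in L^2 of the half-line, with squared norm 1 / (2 a). *)
Definition laguerre_fun a n : R -> R := exp_poly a (laguerre a n).

Lemma coef_laguerre a n k : (laguerre a n)`_k = 'C(n, k)%:R * ((- (2 * a)) ^+ k / k`!%:R).
Proof.
rewrite coef_poly; case: ltnP => // nk.
by rewrite bin_small// mul0r.
Qed.

Lemma L2_laguerre_fun a n : 0 < a -> L2 (laguerre_fun a n).
Proof. exact: L2_exp_poly. Qed.

Lemma fact_neq0 k : k`!%:R != 0 :> R.
Proof. by rewrite pnatr_eq0 -lt0n fact_gt0. Qed.

(** Integrated term by term, the sum is the binomial expansion of
    (1 - 2 a / (s + a))^n / (s + a). This formula turns Laguerre series of f into power series
    for the Laplace transform of f. *)
Lemma ip_exp_laguerre_fun a s n : 0 < a -> 0 < s ->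
  ip (exp_poly s 1) (laguerre_fun a n) = (s - a) ^+ n / (s + a) ^+ n.+1.
Proof.
move=> a0 s0; have sa0 : s + a != 0 by rewrite gt_eqF// addr_gt0.
rewrite ip_exp_poly// mul1r (@laplace_polyE _ _ _ n.+1) ?size_poly//.
have -> : s - a = (s + a) - 2 * a by ring.
rewrite exprBn mulr_suml; apply: eq_bigr => -[k /=]; rewrite ltnS => kn _.
have -> : (s + a) ^+ n.+1 = (s + a) ^+ (n - k) * (s + a) ^+ k.+1.
  by rewrite -exprD addnS subnK.
rewrite coef_laguerre (exprNn (2 * a)) (exprS (s + a)).
have /expf_neq0 h1 := sa0.
by rewrite -mulr_natr; field; rewrite sa0 !h1 fact_neq0.
Qed.

(** Summation by parts with Pascal's rule; it lowers the degree of a polynomial F. *)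
Lemma alternating_bin_rec n (F : nat -> R) :
  \sum_(k < n.+2) (-1) ^+ k * 'C(n.+1, k)%:R * F k =
  \sum_(k < n.+1) (-1) ^+ k * 'C(n, k)%:R * (F k - F k.+1).
Proof.
rewrite big_ord_recl /= bin0 !mul1r.
under eq_bigr do rewrite /bump leq0n add1n binS natrD mulrDr mulrDl.
rewrite big_split /= addrA.
under [in RHS]eq_bigr do rewrite mulrBr.
rewrite sumrB -sumrN; congr (_ + _).
  rewrite [in RHS]big_ord_recl /= bin0 !mul1r; congr (_ + _).
  rewrite big_ord_recr /= bin_small// mulr0 mul0r addr0.
  by apply: eq_bigr => i _.
by apply: eq_bigr => i _; rewrite exprS; ring.
Qed.

(** Up to sign, the n-th difference of a polynomial of degree m <= n in k. *)
Lemma alternating_bin n m j : (m <= n)%N ->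
  \sum_(k < n.+1) (-1) ^+ k * 'C(n, k)%:R * 'C(m + j + k, m)%:R =
  ((-1) ^+ n * (m == n)%:R :> R).
Proof.
elim: n m j => [|n IH] m j.
  by rewrite leqn0 => /eqP ->; rewrite big_ord1 /= bin0 !mul1r bin0.
rewrite (@alternating_bin_rec n (fun k => 'C(m + j + k, m)%:R)).
case: m => [_|m mn].
  by rewrite mulr0 big1// => k _; rewrite !bin0 subrr mulr0.
rewrite eqSS exprS -mulrA -(IH m j.+1 mn) mulN1r -sumrN.
apply: eq_bigr => k _; rewrite addnS binS natrD opprD addrA subrr add0r mulrN.
by rewrite addSn -addnS.
Qed.

Lemma ip_monom_laguerre_fun a m n : 0 < a -> (m <= n)%N ->
  ip (exp_poly a 'X^m) (laguerre_fun a n) = (m == n)%:R * ((-1) ^+ n * m`!%:R / (2 * a) ^+ m.+1).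
Proof.
move=> a0 mn; rewrite ip_exp_poly// (@laplace_polyE _ _ _ (m + n.+1)); last first.
  apply: (leq_trans (size_polyMleq _ _)); rewrite size_polyXn addSn /=.
  by rewrite leq_add2l size_poly.
have a20 : 2 * a != 0 by rewrite gt_eqF// mulr_gt0.
have /expf_neq0 h1 := a20.
rewrite big_split_ord /= big1 ?add0r; last first.
  by move=> k _; rewrite coefXnM ltn_ord !mul0r.
have -> : (m == n)%:R * ((-1) ^+ n * m`!%:R / (2 * a) ^+ m.+1) =
  ((-1) ^+ n * (m == n)%:R) * (m`!%:R / (2 * a) ^+ m.+1) by move=> *; ring.
rewrite -(alternating_bin 0 mn) mulr_suml.
apply: eq_bigr => k _; rewrite coefXnM ltnNge leq_addr /= addKn coef_laguerre addn0.
have -> : (m + k)`!%:R = 'C(m + k, m)%:R * m`!%:R * k`!%:R :> R.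
  by rewrite -!natrM -mulnA -(bin_fact (leq_addr k m)) addKn.
rewrite -addnS exprD -mulr2n -(mulr_natl a 2) (exprNn (2 * a)) (exprS _ k) (exprS _ m).
by field; rewrite ?h1 ?a20 ?fact_neq0 ?(gt_eqF a0).
Qed.

Lemma ip_laguerre_fun_low_degree a p n : 0 < a -> (size p <= n)%N -> ip (exp_poly a p) (laguerre_fun a n) = 0.
Proof.
move=> a0 pn; have -> : exp_poly a p = (fun x => \sum_(k < size p) p`_k * exp_poly a 'X^k x).
  by apply/funext => x; exact: exp_poly_sum.
have h k : L2 (fun x => p`_k * exp_poly a 'X^k x) by apply: L2Z; exact: L2_exp_poly.
rewrite (ip_suml _ h (L2_laguerre_fun n a0)) big1// => k _.
have kn : (k < n)%N by rewrite (leq_trans _ pn).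
by rewrite ipZl ?ip_monom_laguerre_fun ?(ltn_eqF kn) ?mul0r ?mulr0 ?(ltnW kn)//;
  [exact: L2_exp_poly|exact: L2_laguerre_fun].
Qed.

Lemma laguerre_fun_sum a m : laguerre_fun a m = (fun x => \sum_(k < m.+1) (laguerre a m)`_k * exp_poly a 'X^k x).
Proof.
apply/funext => x; rewrite /laguerre_fun /exp_poly (@horner_coef_wide _ m.+1) ?size_poly//.
by rewrite mulr_suml; apply: eq_bigr => k _; rewrite hornerXn mulrA.
Qed.

(** Only the leading monomial of the factor of lower degree can contribute. *)
Lemma ip_laguerre_fun a n m : 0 < a -> ip (laguerre_fun a n) (laguerre_fun a m) = (n == m)%:R / (2 * a).
Proof.
move=> a0; have a20 : 2 * a != 0 by rewrite gt_eqF// mulr_gt0.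
have [nm|mn|->] := ltngtP n m.
- by rewrite mul0r ip_laguerre_fun_low_degree// (leq_trans (size_poly _ _)).
- by rewrite mul0r ipC ip_laguerre_fun_low_degree// (leq_trans (size_poly _ _)).
have h k : L2 (fun x => (laguerre a m)`_k * exp_poly a 'X^k x) by apply: L2Z; exact: L2_exp_poly.
rewrite {1}laguerre_fun_sum (ip_suml _ h (L2_laguerre_fun m a0)) big_ord_recr /= big1 ?add0r; last first.
  move=> k _; rewrite ipZl ?ip_monom_laguerre_fun ?(ltn_eqF (ltn_ord k)) ?mul0r ?mulr0 ?(ltnW (ltn_ord k))//;
  [exact: L2_exp_poly|exact: L2_laguerre_fun].
rewrite ipZl ?ip_monom_laguerre_fun// ?eqxx ?coef_laguerre ?binn; [|exact: L2_exp_poly|exact: L2_laguerre_fun].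
rewrite (exprS (2 * a)) (exprNn (2 * a)).
transitivity (((-1) ^+ m * (-1) ^+ m) / (2 * a) : R).
  have := expf_neq0 m a20; move: ((2 * a) ^+ m) => A A0.
  by rewrite mulr1n; field; rewrite A0 fact_neq0 gt_eqF.
by rewrite -exprMn mulrNN mulr1 expr1n.
Qed.

(** Both sides have the same coefficients because the coefficients p_k of the polynomial satisfy
    (k + 1)^2 p_(k+1) = - 2 a (n - k) p_k. *)
Lemma laguerre_ode a n : 'X * (laguerre a n)^`()^`() + (1 - (2 * a) *: 'X) * (laguerre a n)^`() =
  - (2 * a * n%:R) *: laguerre a n.
Proof.
apply/polyP => k; rewrite coefD mulrBl mul1r coefB -scalerAl !coefZ.
have h j : (j.+1%:R) ^+ 2 * (laguerre a n)`_j.+1 = - (2 * a) * (n%:R - j%:R) * (laguerre a n)`_j :> R.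
  rewrite !coef_laguerre.
  have [jn|nj] := leqP j n; last by rewrite !bin_small ?mul0r ?mulr0// ltnW.
  rewrite factS natrM (exprS (- (2 * a))).
  have e : j.+1%:R * 'C(n, j.+1)%:R = (n%:R - j%:R) * 'C(n, j)%:R :> R.
    by rewrite -natrB// -!natrM mul_bin_left.
  transitivity ((- (2 * a)) ^+ j / j`!%:R * (- (2 * a)) * (j.+1%:R * 'C(n, j.+1)%:R)).
    by field; rewrite fact_neq0 nat1r pnatr_eq0.
  by rewrite e; ring.
rewrite !coefXM !coef_deriv; case: k => [|k] /=.
  have := h 0%N; rewrite expr1n !mul1r subr0 => h0.
  by rewrite add0r mulr0 subr0 mulr1n h0; ring.
rewrite -(mulr_natl (_ *+ _) k.+1) -(mulr_natl (laguerre a n)`_k.+2) -(mulr_natl (laguerre a n)`_k.+1).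
have h1 := h k.+1.
transitivity ((k.+2%:R) ^+ 2 * (laguerre a n)`_k.+2 - 2 * a * (k.+1%:R * (laguerre a n)`_k.+1)).
  by rewrite -[k.+2%:R]natr1; ring.
by rewrite h1; ring.
Qed.

(** Multiplied by e^(-a x), the left-hand side is twice the derivative of x times the Laguerre
    function of index n, which is thus a combination of three neighbouring Laguerre functions. *)
Lemma laguerre_dilation a n :
  2 *: (laguerre a n + 'X * (laguerre a n)^`() - a *: ('X * laguerre a n)) =
  laguerre a n + n.+1%:R *: laguerre a n.+1 - n%:R *: laguerre a n.-1.
Proof.
apply/polyP => k; rewrite !(coefZ, coefD, coefN, coefXM) coef_deriv.
case: k => [|k] /=.
  by rewrite !coef_laguerre !bin0 -[n.+1%:R]natr1; ring.
rewrite !coef_laguerre; set q := (- (2 * a)) ^+ k / k`!%:R.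
have -> : (- (2 * a)) ^+ k.+1 / k.+1`!%:R = - (2 * a) / k.+1%:R * q.
  by rewrite /q factS natrM exprS; field; rewrite fact_neq0 nat1r pnatr_eq0.
have e1 : n%:R * 'C(n.-1, k.+1)%:R = (n%:R - k.+1%:R) * 'C(n, k.+1)%:R :> R.
  case: n => [|n]; first by rewrite mul0r bin_small// mulr0.
  rewrite -natrM mul_bin_down.
  have [kn|nk] := leqP k.+1 n.+1; first by rewrite -natrB// natrM.
  by rewrite bin_small// muln0 mulr0.
have e2 : n.+1%:R * 'C(n.+1, k.+1)%:R = n.+1%:R * ('C(n, k.+1)%:R + 'C(n, k)%:R) :> R.
  by rewrite binS natrD.
have e3 : k.+1%:R * 'C(n, k.+1)%:R = (n%:R - k%:R) * 'C(n, k)%:R :> R.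
  have [kn|nk] := leqP k n; first by rewrite -natrB// -!natrM mul_bin_left.
  by rewrite !bin_small ?mulr0// ltnW.
have k0 : k.+1%:R != 0 :> R by rewrite pnatr_eq0.
transitivity ((- (2 * a) / k.+1%:R * q) * ('C(n, k.+1)%:R + n.+1%:R * 'C(n.+1, k.+1)%:R
  - n%:R * 'C(n.-1, k.+1)%:R)); last by ring.
rewrite e1 e2 -(mulr_natl (_ * _) k.+1).
transitivity ((- (2 * a) / k.+1%:R * q) * (2 * 'C(n, k.+1)%:R + 2 * (k.+1%:R * 'C(n, k.+1)%:R)
  + k.+1%:R * 'C(n, k)%:R)); first by field; rewrite nat1r.
have -> : 'C(n, k.+1)%:R + n.+1%:R * ('C(n, k.+1)%:R + 'C(n, k)%:R) -
    (n%:R - k.+1%:R) * 'C(n, k.+1)%:R =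
  2 * 'C(n, k.+1)%:R + k.+1%:R * 'C(n, k.+1)%:R + n.+1%:R * 'C(n, k)%:R :> R.
  by rewrite -[n.+1%:R]natr1; ring.
by rewrite e3; congr (_ * _); rewrite -[k.+1%:R]natr1 -[n.+1%:R]natr1; ring.
Qed.

End LaguerreFunctions.

(** * Bessel inequality and Laplace transforms as power series *)

Section LaguerreDefect.
Context {R : realType}.
Implicit Types (a s x : R) (n m K : nat) (f g : R -> R).

Definition laguerre_coef a f n : R := ip f (laguerre_fun a n).

(** The factor 2 a compensates the squared norm 1 / (2 a) of the Laguerre functions. *)
Definition laguerre_proj a K f x : R := \sum_(n < K) (2 * a * laguerre_coef a f n) * laguerre_fun a n x.

(** The squared distance from f to the span of the first K Laguerre functions, see defectE. *)
Definition defect a K f : R := ip f f - 2 * a * \sum_(n < K) laguerre_coef a f n ^+ 2.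

Lemma L2_laguerre_proj a K f : 0 < a -> L2 (laguerre_proj a K f).
Proof.
move=> a0; apply: (@L2_sum _ K (fun n x => (2 * a * laguerre_coef a f n) * laguerre_fun a n x)) => n.
by apply: L2Z; exact: L2_laguerre_fun.
Qed.

Lemma ip_laguerre_proj a K f g : 0 < a -> L2 g ->
  ip (laguerre_proj a K f) g = 2 * a * \sum_(n < K) laguerre_coef a f n * laguerre_coef a g n.
Proof.
move=> a0 hg.
have hL n : L2 (fun x => (2 * a * laguerre_coef a f n) * laguerre_fun a n x) by apply: L2Z; exact: L2_laguerre_fun.
rewrite (ip_suml _ hL hg) mulr_sumr; apply: eq_bigr => n _.
by rewrite ipZl//; [rewrite (ipC _ g) mulrA|exact: L2_laguerre_fun].
Qed.

Lemma laguerre_coef_proj a K f n : 0 < a -> (n < K)%N -> laguerre_coef a (laguerre_proj a K f) n = laguerre_coef a f n.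
Proof.
move=> a0 nK; have a20 : 2 * a != 0 by rewrite gt_eqF// mulr_gt0.
rewrite /laguerre_coef ip_laguerre_proj//; last exact: L2_laguerre_fun.
rewrite (bigD1 (Ordinal nK))//= big1 ?addr0.
  by rewrite /laguerre_coef ip_laguerre_fun// eqxx mulr1n; field; rewrite gt_eqF.
move=> i iN.
have {iN} iN : (nat_of_ord i == n) = false.
  by apply/negbTE; apply: contra iN => /eqP e; apply/eqP/val_inj.
by rewrite /laguerre_coef ip_laguerre_fun// eq_sym iN mul0r mulr0.
Qed.

Lemma defectE a K f : 0 < a -> L2 f ->
  defect a K f = ip (fun x => f x - laguerre_proj a K f x) (fun x => f x - laguerre_proj a K f x).
Proof.
move=> a0 hf; have hP := L2_laguerre_proj K f a0.
rewrite ip_sub_sqr// (ipC f) !ip_laguerre_proj//.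
have -> : \sum_(n < K) laguerre_coef a f n * laguerre_coef a (laguerre_proj a K f) n = \sum_(n < K) laguerre_coef a f n ^+ 2.
  by apply: eq_bigr => n _; rewrite laguerre_coef_proj// expr2.
have -> : \sum_(n < K) laguerre_coef a f n * laguerre_coef a f n = \sum_(n < K) laguerre_coef a f n ^+ 2.
  by apply: eq_bigr => n _; rewrite expr2.
by rewrite /defect; ring.
Qed.

Lemma defect_ge0 a K f : 0 < a -> L2 f -> 0 <= defect a K f.
Proof. by move=> a0 hf; rewrite defectE// ip_ge0. Qed.

Lemma defect_le a K f : 0 < a -> defect a K f <= ip f f.
Proof.
move=> a0; rewrite /defect lerBlDr lerDl mulr_ge0 ?sumr_ge0 ?mulr_ge0 ?ltW// => *.
exact: sqr_ge0.
Qed.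

Lemma bessel a K f : 0 < a -> L2 f -> 2 * a * \sum_(n < K) laguerre_coef a f n ^+ 2 <= ip f f.
Proof. by move=> a0 hf; have := defect_ge0 K a0 hf; rewrite /defect subr_ge0. Qed.

(** The parallelogram law for the nonnegative quadratic form defect. *)
Lemma defectD a K f g : 0 < a -> L2 f -> L2 g ->
  defect a K (fun x => f x + g x) <= 2 * defect a K f + 2 * defect a K g.
Proof.
move=> a0 hf hg; have := defect_ge0 K a0 (L2B hf hg).
suff : defect a K (fun x => f x + g x) + defect a K (fun x => f x - g x) =
  2 * defect a K f + 2 * defect a K g by lra.
rewrite /defect ip_add_sqr// ip_sub_sqr//.
have e1 : \sum_(n < K) laguerre_coef a (fun x => f x + g x) n ^+ 2 =
   \sum_(n < K) (laguerre_coef a f n + laguerre_coef a g n) ^+ 2.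
  by apply: eq_bigr => n _; rewrite /laguerre_coef ipDl//; exact: L2_laguerre_fun.
have e2 : \sum_(n < K) laguerre_coef a (fun x => f x - g x) n ^+ 2 =
   \sum_(n < K) (laguerre_coef a f n - laguerre_coef a g n) ^+ 2.
  by apply: eq_bigr => n _; rewrite /laguerre_coef ipBl//; exact: L2_laguerre_fun.
have e3 : \sum_(n < K) (laguerre_coef a f n + laguerre_coef a g n) ^+ 2 + \sum_(n < K) (laguerre_coef a f n - laguerre_coef a g n) ^+ 2
  = 2 * \sum_(n < K) laguerre_coef a f n ^+ 2 + 2 * \sum_(n < K) laguerre_coef a g n ^+ 2.
  by rewrite !mulr_sumr -!big_split /=; apply: eq_bigr => n _; ring.
rewrite e1 e2.
transitivity (2 * ip f f + 2 * ip g g - 2 * a * (\sum_(n < K) (laguerre_coef a f n + laguerre_coef a g n) ^+ 2 + \sum_(n < K) (laguerre_coef a f n - laguerre_coef a g n) ^+ 2)); first by ring.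
by rewrite e3; ring.
Qed.

Lemma defectZ a K k f : 0 < a -> L2 f -> defect a K (fun x => k * f x) = k ^+ 2 * defect a K f.
Proof.
move=> a0 hf; rewrite /defect ipZl//; last exact: L2Z.
rewrite ipZr//.
have -> : \sum_(n < K) laguerre_coef a (fun x => k * f x) n ^+ 2 = k ^+ 2 * \sum_(n < K) laguerre_coef a f n ^+ 2.
  rewrite mulr_sumr; apply: eq_bigr => n _.
  by rewrite /laguerre_coef ipZl//; [rewrite exprMn|exact: L2_laguerre_fun].
by ring.
Qed.

Lemma laguerre_coef_exp a s n : 0 < a -> 0 < s ->
  laguerre_coef a (exp_poly s 1) n = ((s - a) / (s + a)) ^+ n / (s + a).
Proof.
move=> a0 s0; have sa0 : s + a != 0 by rewrite gt_eqF// addr_gt0.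
by rewrite /laguerre_coef ip_exp_laguerre_fun// exprS expr_div_n; field; rewrite sa0 expf_neq0.
Qed.

(** The Laguerre coefficients of e^(-s x) are geometric, and the full geometric series sums to
    1 / (2 s), the squared norm of e^(-s x). *)
Lemma defect_exp a K s : 0 < a -> 0 < s ->
  defect a K (exp_poly s 1) = ((s - a) / (s + a)) ^+ (2 * K) / (2 * s).
Proof.
move=> a0 s0; have sa0 : s + a != 0 by rewrite gt_eqF// addr_gt0.
rewrite /defect ip_exp_poly// mul1r (@laplace_polyE _ _ _ 1) ?size_poly1// big_ord1 coef1 /= fact0 expr1 mulr1n.
under eq_bigr do rewrite laguerre_coef_exp//.
elim: K => [|K IH]; first by rewrite big_ord0 muln0 expr0; field; rewrite ?gt_eqF// addr_gt0.
rewrite big_ord_recr /= mulrDr opprD addrA IH mulnS exprD.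
have -> : ((s - a) / (s + a)) ^+ (2 * K) = (((s - a) / (s + a)) ^+ K) ^+ 2 by rewrite mulnC exprM.
move: (((s - a) / (s + a)) ^+ K) => z.
by field; rewrite sa0 (gt_eqF s0).
Qed.

(** With z = (s - a) / (s + a), the Laplace transform of f at s is 2 a / (s + a) times the power
    series with coefficients laguerre_coef a f n, evaluated at z. The error of a partial sum is
    the inner product of f with e^(-s x) minus its projection, whose norm is a defect. *)
Lemma ip_exp_approx a K s f : 0 < a -> 0 < s -> L2 f ->
  (ip (exp_poly s 1) f - 2 * a / (s + a) * \sum_(n < K) laguerre_coef a f n * ((s - a) / (s + a)) ^+ n) ^+ 2
  <= ip f f * (((s - a) / (s + a)) ^+ (2 * K) / (2 * s)).
Proof.
move=> a0 s0 hf; have hs := L2_exp_poly 1 s0; have hP := L2_laguerre_proj K (exp_poly s 1) a0.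
have -> : 2 * a / (s + a) * \sum_(n < K) laguerre_coef a f n * ((s - a) / (s + a)) ^+ n =
   ip (laguerre_proj a K (exp_poly s 1)) f.
  rewrite ip_laguerre_proj// -mulrA !mulr_sumr; apply: eq_bigr => n _.
  by rewrite laguerre_coef_exp//; ring.
rewrite -ipBl// -defect_exp// defectE// mulrC.
by apply: cauchy_schwarz => //; exact: L2B.
Qed.

End LaguerreDefect.

(** * Weierstrass approximation *)

Section Bernstein.
Context {R : realType}.
Implicit Types (u : R) (n k : nat).

Definition bernstein n k u : R := 'C(n, k)%:R * u ^+ k * (1 - u) ^+ (n - k).

Lemma bernstein_sum n u : \sum_(k < n.+1) bernstein n k u = 1.
Proof.
have : ((1 - u) + u) ^+ n = 1 by rewrite subrK expr1n.
rewrite exprDn => <-; apply: eq_bigr => k _.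
by rewrite /bernstein -mulr_natl; ring.
Qed.

Lemma bernstein_ge0 n k u : 0 <= u <= 1 -> 0 <= bernstein n k u.
Proof.
by case/andP => u0 u1; rewrite /bernstein !mulr_ge0 ?exprn_ge0 ?subr_ge0.
Qed.

(** k C(n+1, k) = (n+1) C(n, k-1): this computes the moments of the binomial law one after the
    other. *)
Lemma bernstein_shift n u (g : nat -> R) :
  \sum_(k < n.+2) k%:R * bernstein n.+1 k u * g k = n.+1%:R * u * \sum_(k < n.+1) bernstein n k u * g k.+1.
Proof.
rewrite big_ord_recl /= !mul0r add0r mulr_sumr; apply: eq_bigr => k _.
rewrite /bump leq0n add1n /bernstein subSS exprS.
have e : k.+1%:R * 'C(n.+1, k.+1)%:R = n.+1%:R * 'C(n, k)%:R :> R.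
  by rewrite -!natrM mul_bin_diag.
transitivity ((k.+1%:R * 'C(n.+1, k.+1)%:R) * (u * u ^+ k) * (1 - u) ^+ (n - k) * g k.+1).
  by ring.
by rewrite e; ring.
Qed.

Lemma bernstein_mean n u : \sum_(k < n.+1) k%:R * bernstein n k u = n%:R * u.
Proof.
case: n => [|n]; first by rewrite big_ord1 !mul0r.
transitivity (\sum_(k < n.+2) k%:R * bernstein n.+1 k u * 1).
  by apply: eq_bigr => k _; rewrite mulr1.
rewrite (bernstein_shift n u (fun=> 1)) -[RHS]mulr1; congr (_ * _).
by under eq_bigr do rewrite mulr1; exact: bernstein_sum.
Qed.

Lemma bernstein_variance n u :
  \sum_(k < n.+2) bernstein n.+1 k u * (u - k%:R / n.+1%:R) ^+ 2 = u * (1 - u) / n.+1%:R.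
Proof.
have n0 : n.+1%:R != 0 :> R by rewrite pnatr_eq0.
have m0 := bernstein_sum n.+1 u.
have m1 := bernstein_mean n.+1 u.
have m2 : \sum_(k < n.+2) k%:R * bernstein n.+1 k u * k%:R = n.+1%:R * u * (n%:R * u + 1).
  rewrite (bernstein_shift n u (fun k => k%:R)); congr (_ * _).
  have <- := bernstein_mean n u; have e := bernstein_sum n u; rewrite -[X in _ = _ + X]e -big_split /=.
  by apply: eq_bigr => k _; rewrite -natr1; ring.
transitivity (u ^+ 2 * \sum_(k < n.+2) bernstein n.+1 k u -
  2 * u / n.+1%:R * (\sum_(k < n.+2) k%:R * bernstein n.+1 k u) +
  (n.+1%:R ^- 2) * \sum_(k < n.+2) k%:R * bernstein n.+1 k u * k%:R).
  rewrite !mulr_sumr -sumrN -!big_split /=; apply: eq_bigr => k _.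
  by field; rewrite nat1r.
rewrite m0 m1 m2 -[n.+1%:R]natr1; field.
by rewrite natr1.
Qed.

(** Compactness of [0, 1], in the form of near coverings. *)
Lemma uniformly_continuous01 (h : R -> R) (e : R) : continuous h -> 0 < e ->
  exists2 d : R, 0 < d & forall u v, 0 <= u <= 1 -> `|u - v| < d -> `|h u - h v| <= e.
Proof.
move=> ch e0.
have := @segment_compact R 0 1 => /compact_near_coveringP.
move=> /(_ _ (0:R)^'+ (fun d u => forall v, `|u - v| < d -> `|h u - h v| <= e)).
case.
  move=> u _; have /cvgrPdist_lt/(_ (e / 2)) := ch u.
  rewrite divr_gt0// => /(_ isT) [/= r r0 hr].
  exists (ball u (r / 2), [set d | d < r / 2]).
    split; first by apply: nbhsx_ballx; rewrite divr_gt0.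
    by apply: nbhs_right_lt; rewrite divr_gt0.
  move=> [w d] /= [uw dr] v wv.
  have h1 : `|h u - h w| < e / 2.
    by apply: hr; rewrite /= (lt_trans uw)// ltr_pdivrMr// ltr_pMr// ltr1n.
  have h2 : `|h u - h v| < e / 2.
    apply: hr; rewrite /= -(subrK w u) -addrA (le_lt_trans (ler_normD _ _))//.
    by rewrite [ltRHS]splitr ltrD// (lt_trans wv).
  rewrite -(subrK (h u) (h w)) -addrA (le_trans (ler_normD _ _))//.
  by rewrite [leRHS]splitr lerD// ltW// distrC.
move=> r /= r0 hr; exists (r / 2); first by rewrite divr_gt0.
move=> u v u01 uv; apply: (hr (r / 2)) => //=.
- by rewrite sub0r normrN gtr0_norm ?divr_gt0// ltr_pdivrMr// ltr_pMr// ltr1n.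
- by rewrite divr_gt0.
Qed.

(** Bernstein polynomials: near u uniform continuity controls h u - h (k / n), and away from u the
    Chebyshev bound |h u - h v| <= C (u - v)^2 reduces the error to the variance, of order 1 / n. *)
Lemma weierstrass (h : R -> R) (M e : R) : continuous h -> (forall u, `|h u| <= M) -> 0 < e ->
  exists p : {poly R}, forall u, 0 <= u <= 1 -> `|h u - p.[u]| <= e.
Proof.
move=> ch hM e0; have e20 : 0 < e / 2 by rewrite divr_gt0.
have [d d0 hd] := uniformly_continuous01 ch e20.
have M0 : 0 <= M by apply: le_trans (hM 0).
(* |h u - h v| <= 2 M <= C (u - v)^2 as soon as |u - v| >= d *)
pose C := 2 * M / d ^+ 2.
have C0 : 0 <= C by rewrite /C divr_ge0 ?mulr_ge0 ?exprn_ge0 ?(ltW d0).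
have C20 : 0 <= C / (e / 2) by rewrite divr_ge0 ?(ltW e20).
have := archi_boundP C20; set n := Num.Def.archi_bound _ => nC.
have n1 : 0 < n.+1%:R :> R by rewrite ltr0n.
have Cn : C / n.+1%:R <= e / 2.
  rewrite ler_pdivrMr// mulrC -ler_pdivrMr// ltW// (lt_le_trans nC)// ler_nat.
  exact: leqnSn.
pose p : {poly R} := \sum_(k < n.+2)
  (h (k%:R / n.+1%:R) * 'C(n.+1, k)%:R) *: ('X ^+ k * (1 - 'X) ^+ (n.+1 - k)).
exists p => u u01.
have -> : p.[u] = \sum_(k < n.+2) bernstein n.+1 k u * h (k%:R / n.+1%:R).
  rewrite /p horner_sum; apply: eq_bigr => k _.
  by rewrite hornerZ hornerM !horner_exp hornerX hornerD hornerN hornerX hornerC /bernstein; ring.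
have -> : h u = \sum_(k < n.+2) bernstein n.+1 k u * h u by rewrite -mulr_suml bernstein_sum mul1r.
rewrite -sumrB (le_trans (ler_norm_sum _ _ _))//.
apply: (@le_trans _ _ (\sum_(k < n.+2)
   (e / 2 * bernstein n.+1 k u + C * (bernstein n.+1 k u * (u - k%:R / n.+1%:R) ^+ 2)))).
  apply: ler_sum => k _; rewrite -mulrBr normrM ger0_norm ?bernstein_ge0//.
  rewrite [leRHS](_ : _ = bernstein n.+1 k u * (e / 2 + C * (u - k%:R / n.+1%:R) ^+ 2)); last by ring.
  apply: ler_wpM2l; first exact: bernstein_ge0.
  set v := k%:R / _; have [uv|uv] := ltP `|u - v| d.
    by rewrite (le_trans (hd _ _ u01 uv))// lerDl mulr_ge0 ?sqr_ge0.
  apply: (@le_trans _ _ (2 * M)).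
    by rewrite (le_trans (ler_normB _ _))// mulr_natl mulr2n lerD.
  apply: (@le_trans _ _ (C * d ^+ 2)).
    by rewrite /C -mulrA mulVf ?mulr1// expf_neq0// gt_eqF.
  apply: (@le_trans _ _ (C * (u - v) ^+ 2)); last by rewrite lerDr ltW.
  apply: ler_wpM2l => //; rewrite -(real_normK (num_real (u - v))).
  by rewrite lerXn2r ?nnegrE// ltW.
rewrite big_split /= -!mulr_sumr bernstein_sum bernstein_variance mulr1 [leRHS]splitr lerD2l.
apply: le_trans Cn; apply: ler_wpM2l => //.
have /andP[u0 u1] := u01.
by rewrite ler_pdivrMr// mulVf ?gt_eqF//; nra.
Qed.

End Bernstein.

(** * Exponentials are limits of Laguerre series *)

Section Completeness.
Context {R : realType}.
Implicit Types (a s x u : R) (n m K : nat) (f g : R -> R).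
Local Notation mu := (@lebesgue_measure R).
Local Notation D := (`]0, +oo[%classic : set R).

Lemma Rintegral_dominated_cvg E (F : nat -> R -> R) (f g : R -> R) : measurable E ->
  (forall n, measurable_fun E (F n)) ->
  (forall x, E x -> F n x @[n --> \oo] --> f x) ->
  mu.-integrable E (EFin \o g) ->
  (forall n x, E x -> `|F n x| <= g x) ->
  mu.-integrable E (EFin \o f) /\
  (\int[mu]_(x in E) F n x @[n --> \oo] --> \int[mu]_(x in E) f x).
Proof.
move=> mE mF cF ig Fg.
have mf : measurable_fun E f by apply: (measurable_fun_cvg mF).
have [] := @dominated_convergence _ _ _ mu E mE (fun n => EFin \o F n) (EFin \o f) (EFin \o g).
- by move=> n; apply/measurable_EFinP; exact: mF.
- exact/measurable_EFinP.
- by apply: aeW => x Ex; apply: cvg_EFin; [exact: nearW|exact: cF].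
- by [].
- by apply: aeW => x n Ex; rewrite /= lee_fin Fg.
move=> i_f _ cvg; split => //; apply: fine_cvg.
by rewrite fineK//; exact: integrable_fin_num.
Qed.

(** The combinations of e^(-x), e^(-2 x), ... ; they are polynomials in u = e^(-x) that vanish at
    u = 0. *)
Definition expsum (p : {poly R}) x : R := expR (- x) * p.[expR (- x)].

Lemma expsumE p x : expsum p x = \sum_(k < size p) p`_k * exp_poly k.+1%:R 1 x.
Proof.
rewrite /expsum horner_coef mulr_sumr; apply: eq_bigr => k _.
by rewrite /exp_poly hornerC mul1r mulrCA -exprS -expRM_natl mulrN.
Qed.

(** f is the limit of its Laguerre series. *)
Definition spanned a f := forall e, 0 < e -> exists K0, forall K, (K0 <= K)%N -> defect a K f <= e.

Lemma spanned_exp a s : 0 < a -> 0 < s -> spanned a (exp_poly s 1).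
Proof.
move=> a0 s0 e e0; pose z := ((s - a) / (s + a)) ^+ 2.
have sa0 : 0 < s + a by rewrite addr_gt0.
have z1 : `|z| < 1.
  rewrite ger0_norm ?sqr_ge0// /z expr_div_n ltr_pdivrMr ?exprn_gt0// mul1r.
  by rewrite -subr_gt0 subr_sqr; nra.
have /cvgrPdist_lt/(_ (e * (2 * s))) := cvg_expr z1.
rewrite !mulr_gt0// => /(_ isT) [K0 _ hK]; exists K0 => K /hK /=.
have zK0 : 0 <= z ^+ K by apply: exprn_ge0; exact: sqr_ge0.
rewrite sub0r normrN (ger0_norm zK0) => zK.
by rewrite defect_exp// exprM ler_pdivrMr ?mulr_gt0// ltW.
Qed.

Lemma spannedD a f g : 0 < a -> L2 f -> L2 g -> spanned a f -> spanned a g ->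
  spanned a (fun x => f x + g x).
Proof.
move=> a0 hf hg cf cg e e0.
have e4 : 0 < e / 4 by rewrite divr_gt0.
have [K1 h1] := cf _ e4; have [K2 h2] := cg _ e4.
exists (maxn K1 K2) => K; rewrite geq_max => /andP[/h1 {}h1 /h2 {}h2].
by have := defectD K a0 hf hg; lra.
Qed.

Lemma spannedZ a k f : 0 < a -> L2 f -> spanned a f -> spanned a (fun x => k * f x).
Proof.
move=> a0 hf cf e e0; have k1 : 0 < k ^+ 2 + 1 by rewrite ltr_wpDl ?sqr_ge0.
have [K0 hK] := cf _ (divr_gt0 e0 k1); exists K0 => K /hK h.
rewrite defectZ//; apply: le_trans (ler_wpM2l (sqr_ge0 k) h) _.
by rewrite mulrA ler_pdivrMr// mulrC ler_wpM2l ?(ltW e0)// lerDl.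
Qed.

Lemma L2_expsum p : L2 (expsum p).
Proof.
rewrite (_ : expsum p = fun x => \sum_(k < size p) p`_k * exp_poly k.+1%:R 1 x); last first.
  by apply/funext => x; rewrite expsumE.
apply: (@L2_sum _ _ (fun k x => p`_k * exp_poly k.+1%:R 1 x)) => k.
by apply: L2Z; exact: L2_exp_poly.
Qed.

Lemma spanned_expsum a p : 0 < a -> spanned a (expsum p).
Proof.
move=> a0; rewrite (_ : expsum p = fun x => \sum_(k < size p) p`_k * exp_poly k.+1%:R 1 x); last first.
  by apply/funext => x; rewrite expsumE.
have hL k : L2 (fun x => p`_k * exp_poly k.+1%:R 1 x) by apply: L2Z; exact: L2_exp_poly.
elim: (size p) => [|n IH].
  move=> e e0; exists 0%N => K _.
  rewrite (_ : (fun x => _) = (fun=> 0)); last by apply/funext => x; rewrite big_ord0.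
  by apply: le_trans (defect_le _ _ a0) _; rewrite ip0l ltW.
rewrite (_ : (fun x => _) = fun x => \sum_(k < n) p`_k * exp_poly k.+1%:R 1 x + p`_n * exp_poly n.+1%:R 1 x).
  apply: spannedD => //; first exact: (@L2_sum _ _ (fun k x => p`_k * exp_poly k.+1%:R 1 x)).
  by apply: spannedZ => //; [exact: L2_exp_poly|exact: spanned_exp].
by apply/funext => x; rewrite big_ord_recr.
Qed.

(** Weierstrass for g (- ln u) / u in the variable u = e^(-x), extended by 0 near u = 0. *)
Lemma expsum_approx_continuous g n e : continuous g -> (forall x, `|g x| <= n%:R) ->
  (forall x, n%:R <= x -> g x = 0) -> 0 < e ->
  exists p, forall x, 0 < x -> `|g x - expsum p x| <= e * expR (- x).
Proof.
move=> cg gn g0 e0.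
pose h u := if u <= 0 then 0 else g (- ln u) / u.
have h0 u : u < expR (- n%:R) -> h u = 0.
  move=> un; rewrite /h; case: ifPn => // /negP/negP; rewrite -ltNge => u0.
  by rewrite g0 ?mul0r// lerNr -(expRK (- n%:R)) ler_ln ?posrE ?expR_gt0// ltW.
have ch : continuous h.
  move=> u; have [un|un] := ltP u (expR (- n%:R)).
    have h00 : h u = 0 by exact: h0.
    rewrite /continuous_at h00.
    apply: cvg_near_cst; near=> v; rewrite h0//.
    by near: v; exact: lt_nbhsl.
  have u0 : 0 < u by rewrite (lt_le_trans _ un)// expR_gt0.
  rewrite /continuous_at; have -> : h u = g (- ln u) / u by rewrite /h (lt_geF u0).
  have H : g (- ln v) / v @[v --> u] --> g (- ln u) / u.
    apply: cvgM; last by apply: cvgV => //; rewrite gt_eqF.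
    apply: (@cvg_comp _ _ _ (fun v => - ln v) g _ (nbhs (- ln u))); last exact: cg.
    by apply: (@cvgN _ R^o); exact: continuous_ln.
  apply: cvg_trans H; apply: near_eq_cvg; near=> v; rewrite /h lt_geF//.
  by near: v; exact: lt_nbhsr.
have hM u : `|h u| <= n%:R * expR n%:R.
  have [un|un] := ltP u (expR (- n%:R)); first by rewrite h0// normr0 mulr_ge0 ?expR_ge0.
  have u0 : 0 < u by rewrite (lt_le_trans _ un)// expR_gt0.
  rewrite /h (lt_geF u0) normrM ler_pM//.
  rewrite gtr0_norm ?invr_gt0// -[expR n%:R]invrK -expRN lef_pV2 ?posrE ?expR_gt0//.
have [p hp] := weierstrass ch hM e0.
exists p => x x0; have := hp (expR (- x)).
have ex : expR (- x) <= 1 by rewrite -expR0 ler_expR oppr_le0 ltW.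
rewrite expR_ge0 ex => /(_ isT).
rewrite /h (lt_geF (expR_gt0 _)) expRK opprK => H.
have -> : g x - expsum p x = expR (- x) * (g x / expR (- x) - p.[expR (- x)]).
  by rewrite /expsum mulrBr mulrCA mulfV ?mulr1// gt_eqF// expR_gt0.
by rewrite normrM gtr0_norm ?expR_gt0// mulrC ler_wpM2r ?expR_ge0.
Unshelve. all: by end_near. Qed.

End Completeness.

(** * Completeness of the Laguerre functions *)

Section Density.
Context {R : realType}.
Implicit Types (a s x y u : R) (n m K : nat) (f g : R -> R).
Local Notation mu := (@lebesgue_measure R).
Local Notation D := (`]0, +oo[%classic : set R).

Definition clip (M y : R) : R := Num.max (- M) (Num.min M y).

(** A continuous function that is 1 up to n and 0 beyond n + 1. Truncating f with clip and taper,
    rather than with indicator functions, keeps continuous approximants continuous. *)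
Definition taper n x : R := Num.min 1 (Num.max 0 (n.+1%:R - x)).

Lemma clipE M y : clip M y = if M < y then (if - M < M then M else - M) else (if - M < y then y else - M).
Proof. by rewrite /clip minElt maxElt; case: (ltP M y). Qed.

Lemma taperE n x : taper n x =
  if 0 < n.+1%:R - x then (if 1 < n.+1%:R - x then 1 else n.+1%:R - x) else 0.
Proof.
rewrite /taper maxElt minElt; case: (ltP 0 (n.+1%:R - x)) => // h; by rewrite ltr10.
Qed.

Lemma clip_bound M y : 0 <= M -> `|clip M y| <= M.
Proof.
move=> M0; rewrite clipE ler_norml.
by case: (ltP M y) => ?; case: ltP => ?; apply/andP; split; lra.
Qed.

Lemma clip_id M y : `|y| <= M -> clip M y = y.
Proof.
rewrite ler_norml => /andP[? ?]; rewrite clipE.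
by case: (ltP M y) => ?; case: ltP => ?; lra.
Qed.

Lemma clip_lipschitz M y z : `|clip M y - clip M z| <= `|y - z|.
Proof.
have := ler_norm (y - z); have := ler_norm (z - y); rewrite (distrC z y) !clipE => ? ?.
rewrite ler_norml; case: (ltP (- M) M) => ?; case: (ltP M y) => ?; case: (ltP M z) => ?;
  case: (ltP (- M) y) => ?; case: (ltP (- M) z) => ?; by apply/andP; split; lra.
Qed.

Lemma taper01 n x : 0 <= taper n x <= 1.
Proof.
by rewrite taperE; case: ltP => ?; [case: ltP => ?|]; apply/andP; split; lra.
Qed.

Lemma taper1 n x : x <= n%:R -> taper n x = 1.
Proof.
by rewrite taperE -natr1 => ?; case: ltP => ?; [case: ltP => ?|]; lra.
Qed.

Lemma taper0 n x : n.+1%:R <= x -> taper n x = 0.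
Proof.
by rewrite taperE => ?; case: ltP => ?; [case: ltP => ?|]; lra.
Qed.

Lemma taper_clip n M y x : 0 <= M -> `|y - taper n x * clip M y| <= `|y|.
Proof.
move=> M0; have /andP[t0 t1] := taper01 n x.
have [y0|y0] := leP 0 y.
  have h : 0 <= clip M y <= y.
    by rewrite clipE; case: (ltP M y) => ?; case: ltP => ?; apply/andP; split; lra.
  by case/andP: h => h1 h2; rewrite (ger0_norm y0) ler_norml; apply/andP; split; nra.
have h : y <= clip M y <= 0.
  by rewrite clipE; case: (ltP M y) => ?; case: ltP => ?; apply/andP; split; lra.
by case/andP: h => h1 h2; rewrite (ltr0_norm y0) ler_norml; apply/andP; split; nra.
Qed.

Lemma measurable_clip M f (E : set R) : measurable_fun E f -> measurable_fun E (fun x => clip M (f x)).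
Proof.
by move=> mf; apply: measurable_maxr => //; apply: measurable_minr.
Qed.

Lemma continuous_clip M g : continuous g -> continuous (fun x => clip M (g x)).
Proof.
move=> cg x; apply: (@continuous_max _ _ (fun=> - M) (fun x => Num.min M (g x))).
  exact: cst_continuous.
by apply: (@continuous_min _ _ (fun=> M) g); [exact: cst_continuous|exact: cg].
Qed.

Lemma continuous_taper n : continuous (taper n).
Proof.
move=> x; apply: (@continuous_min _ _ (fun=> 1) (fun x => Num.max 0 (n.+1%:R - x))).
  exact: cst_continuous.
apply: (@continuous_max _ _ (fun=> 0) (fun x => n.+1%:R - x)); first exact: cst_continuous.
by apply: (@continuousB _ R^o); [exact: cst_continuous|move=> ?].
Qed.

Lemma measurable_taper n (E : set R) : measurable_fun E (taper n).
Proof. by apply: measurable_funTS; apply: continuous_measurable_fun; exact: continuous_taper. Qed.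

Lemma ipD_le f g : L2 f -> L2 g ->
  ip (fun x => f x + g x) (fun x => f x + g x) <= 2 * ip f f + 2 * ip g g.
Proof.
move=> hf hg; have := ip_ge0 (fun x => f x - g x).
by rewrite ip_sub_sqr// ip_add_sqr//; lra.
Qed.

Lemma L2_truncation f n : L2 f -> L2 (fun x => taper n x * clip n%:R (f x)).
Proof.
move=> hf; have [mf _] := hf; apply: (@L2_le _ _ (fun x => 2 * f x)).
- by apply: measurable_funM; [exact: measurable_taper|exact: measurable_clip].
- exact: L2Z.
move=> x _; have h := @taper_clip n n%:R (f x) x (ler0n _ _).
rewrite (_ : taper n x * _ = f x - (f x - taper n x * clip n%:R (f x))); last by ring.
rewrite (le_trans (ler_normB _ _))// (normrM 2) (ger0_norm (ler0n _ 2)).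
by rewrite mulr_natl mulr2n lerD2l.
Qed.

(** Dominated convergence: the truncation error is at most |f| and vanishes once n >= |x|, |f x|. *)
Lemma truncation_approx f e : L2 f -> 0 < e ->
  exists n, ip (fun x => f x - taper n x * clip n%:R (f x))
               (fun x => f x - taper n x * clip n%:R (f x)) <= e.
Proof.
move=> hf e0; have [mf i_f] := hf.
pose F n x := (f x - taper n x * clip n%:R (f x)) ^+ 2.
have [] := @Rintegral_dominated_cvg R D F (fun=> 0) (fun x => f x ^+ 2).
- exact: measurable_D.
- move=> n; apply: measurable_funX; apply: measurable_funB => //.
  by apply: measurable_funM; [exact: measurable_taper|exact: measurable_clip].
- move=> x _; apply: cvg_near_cst.
  have := archi_boundP (normr_ge0 (f x)); set n1 := Num.Def.archi_bound _ => h1.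
  have := archi_boundP (normr_ge0 x); set n2 := Num.Def.archi_bound _ => h2.
  exists (maxn n1 n2) => // n /=; rewrite geq_max => /andP[n1n n2n].
  rewrite /F taper1 ?clip_id; first by rewrite mul1r subrr expr0n.
    by rewrite (le_trans (ltW h1))// ler_nat.
  by rewrite (le_trans (ler_norm _))// (le_trans (ltW h2))// ler_nat.
- exact: i_f.
- move=> n x _; rewrite ger0_norm ?sqr_ge0// /F.
  rewrite -(real_normK (num_real (f x))) -(real_normK (num_real (f x - _))).
  by rewrite lerXn2r ?nnegrE// taper_clip.
move=> _; rewrite [X in _ --> X](_ : _ = 0); last by rewrite /Rintegral integral0.
move=> /cvgrPdist_lt/(_ e e0) [n _ /(_ n (leqnn n)) /=] h; exists n.
apply: le_trans (ltW h); rewrite sub0r normrN; apply: le_trans (ler_norm _).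
by rewrite le_eqVlt; apply/orP; left; apply/eqP; apply: eq_Rintegral => x _; rewrite /F expr2.
Qed.

(** A continuous L^1 approximant of the clipped function on the bounded interval where the taper
    lives, once clipped itself, is also an L^2 approximant: the square of a difference bounded by
    2 n is at most 2 n times the difference. *)
Lemma continuous_approx f n e : L2 f -> 0 < e -> exists g : R -> R,
  [/\ continuous g, forall x, `|g x| <= n.+1%:R, forall x, n.+1%:R <= x -> g x = 0 &
   ip (fun x => taper n x * clip n%:R (f x) - g x)
      (fun x => taper n x * clip n%:R (f x) - g x) <= e].
Proof.
move=> hf e0; have [mf i_f] := hf.
pose E : set R := `]0, n.+1%:R]%classic.
have ED : E `<=` D by move=> x /=; rewrite /E /= !in_itv/= andbT => /andP[].
have mE : measurable E by exact: measurable_itv.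
have muE : (mu E < +oo)%E.
  by rewrite /E lebesgue_measure_itv/= lte_fin ltr0n /= -EFinB ltry.
pose phi x := clip n%:R (f x).
have mphi : measurable_fun E phi.
  by apply: measurable_clip; exact: measurable_funS mf.
have iphi : mu.-integrable E (EFin \o phi).
  apply: measurable_bounded_integrable => //.
  exists n%:R; split; first exact: num_real.
  by move=> M nM x _; apply: le_trans (ltW nM); exact: clip_bound.
have [g_ [cg ig]] := approximation_continuous_integrable mE muE iphi.
pose d := e / (2 * n.+1%:R).
have n0 : 0 < 2 * n.+1%:R :> R by rewrite mulr_gt0 ?ltr0n.
have d0 : 0 < d by rewrite /d divr_gt0.
move=> /fine_cvg; rewrite /= => /cvgrPdist_lt/(_ d d0) [k _ /(_ k (leqnn k)) /=].
set g := g_ k; rewrite sub0r normrN => hk.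
have ig' : mu.-integrable E (EFin \o (fun x => `|phi x - g x|)).
  apply: (@integrable_norm _ _ _ mu E (fun x => phi x - g x)).
  exact: (@integrableB _ _ _ mu E mE (EFin \o phi) (EFin \o g) iphi (ig k)).
exists (fun x => taper n x * clip n%:R (g x)); split.
- move=> x; apply: continuousM; first exact: continuous_taper.
  by apply: continuous_clip; exact: cg.
- move=> x; rewrite normrM; have /andP[t0 t1] := taper01 n x.
  rewrite (ger0_norm t0); have := clip_bound (g x) (ler0n R n).
  move=> h; apply: (@le_trans _ _ (1 * n%:R)); first by rewrite ler_pM.
  by rewrite mul1r ler_nat.
- by move=> x nx; rewrite taper0// mul0r.
pose w x := (2 * n.+1%:R) * `|phi x - g x|.
have iw : mu.-integrable E (EFin \o w).
  exact: (@integrableZl _ _ _ mu E mE (2 * n.+1%:R) (EFin \o (fun x => `|phi x - g x|))).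
have wP x : (taper n x * clip n%:R (f x) - taper n x * clip n%:R (g x)) ^+ 2 <= (w \_ E) x \/ x <= 0.
  have [x0|x0] := leP x 0; [by right|left].
  rewrite patchE; case: ifPn; last first.
    rewrite notin_setE /E /= in_itv /= x0 /= => /negP; rewrite -ltNge => xn.
    by rewrite (taper0 (ltW xn)) !mul0r subrr expr0n; exact: (lexx (0:R)).
  move=> _; rewrite /w -mulrBr exprMn.
  have /andP[t0 t1] := taper01 n x.
  have b1 := clip_bound (f x) (ler0n R n); have b2 := clip_bound (g x) (ler0n R n).
  have L : `|phi x - clip n%:R (g x)| <= `|phi x - g x|.
    by have := clip_lipschitz n%:R (phi x) (g x); rewrite /phi (clip_id b1).
  have t2 : taper n x ^+ 2 <= 1 by rewrite expr_le1.
  apply: (@le_trans _ _ ((phi x - clip n%:R (g x)) ^+ 2)).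
    by rewrite -[leRHS]mul1r ler_wpM2r ?sqr_ge0.
  rewrite -real_normK ?num_real// expr2 ler_pM//.
  rewrite (le_trans (ler_normB _ _))// mulr_natl mulr2n -natr1 addrACA.
  by rewrite (le_trans (lerD b1 b2))// lerDl.
have iwD : mu.-integrable D (EFin \o (w \_ E)).
  rewrite -restrict_EFin; apply/integrable_restrict => //.
  by rewrite setIidr.
rewrite /ip; apply: (@le_trans _ _ (\int[mu]_(x in D) (w \_ E) x)).
  have hL : L2 (fun x => taper n x * clip n%:R (g x)).
    apply: (@L2_le _ _ (fun x => (n%:R * expR n.+1%:R) * exp_poly 1 1 x)).
    - apply: measurable_funM; first exact: measurable_taper.
      by apply: measurable_clip; apply: measurable_funTS; apply: continuous_measurable_fun; exact: cg.
    - by apply: L2Z; exact: L2_exp_poly.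
    move=> x x0; rewrite /exp_poly hornerC !mul1r; have [nx|xn] := leP n.+1%:R x.
      by rewrite taper0// mul0r normr0.
    rewrite !normrM !(ger0_norm (expR_ge0 _)) (ger0_norm (ler0n _ _)).
    have /andP[t0 t1] := taper01 n x; rewrite (ger0_norm t0).
    have b := clip_bound (g x) (ler0n R n).
    have ex : 1 <= expR n.+1%:R * expR (- x).
      by rewrite -expRD -[leLHS]expR0 ler_expR subr_ge0 ltW.
    apply: (@le_trans _ _ (1 * n%:R)); first by rewrite ler_pM.
    by rewrite mul1r -mulrA ler_peMr.
  have hT := L2_truncation n hf.
  apply: le_Rintegral => //; first by apply: integrable_mul; exact: L2B.
  move=> x /=; rewrite in_itv /= andbT => x0; rewrite -expr2.
  by case: (wP x) => // /(lt_le_trans x0); rewrite ltxx.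
rewrite -Rintegral_mkcondr setIidr// RintegralZl//.
rewrite -ler_pdivlMl// mulrC; apply: le_trans (ltW hk).
by apply: le_trans (ler_norm _).
Qed.

(** By defect_exp every e^(-s x) is spanned, hence so are their combinations, which are dense in
    L^2; the defect is at most the squared norm, so that it tolerates small L^2 errors. *)
Theorem laguerre_complete a f : 0 < a -> L2 f -> spanned a f.
Proof.
move=> a0 hf e e0; have e16 : 0 < e / 32 by rewrite divr_gt0.
have [n hn] := truncation_approx hf e16.
have [g [cg gn g0 hg]] := continuous_approx n hf e16.
(* d <= 1 and d <= e / 32 give d^2 / 2 <= e / 32 *)
pose d := Num.min 1 (e / 32).
have d0 : 0 < d by rewrite /d lt_min ltr01.
have [p hp] := expsum_approx_continuous cg gn g0 d0.
set fn := (fun x => taper n x * clip n%:R (f x)) in hn hg.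
have hfn : L2 fn by exact: L2_truncation.
have hE := L2_expsum p.
have hgp : L2 (fun x => g x - expsum p x).
  apply: (@L2_le _ _ (fun x => d * exp_poly 1 1 x)).
  - apply: measurable_funB; last by case: hE.
    by apply: measurable_funTS; apply: continuous_measurable_fun.
  - by apply: L2Z; exact: L2_exp_poly.
  move=> x x0; apply: le_trans (hp x x0) _.
  by rewrite /exp_poly hornerC !mul1r ger0_norm// mulr_ge0 ?expR_ge0// ltW.
have hg2 : L2 g.
  rewrite (_ : g = fun x => (g x - expsum p x) + expsum p x); first exact: L2D.
  by apply/funext => x; rewrite subrK.
have e3 : ip (fun x => g x - expsum p x) (fun x => g x - expsum p x) <= e / 32.
  have hZ : L2 (fun x => d * exp_poly 1 1 x) by apply: L2Z; exact: L2_exp_poly.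
  apply: (@le_trans _ _ (ip (fun x => d * exp_poly 1 1 x) (fun x => d * exp_poly 1 1 x))).
    apply: ip_le => // x x0; apply: le_trans (hp x x0) _.
    by rewrite /exp_poly hornerC !mul1r ger0_norm// mulr_ge0 ?expR_ge0// ltW.
  rewrite ipZl//; last exact: L2_exp_poly.
  rewrite ipZr; [|exact: L2_exp_poly..].
  rewrite ip_exp_poly// mul1r (@laplace_polyE _ _ _ 1) ?size_poly1// big_ord1 coef1 /= fact0 expr1.
  have d1 : d <= 1 by rewrite /d ge_min lexx.
  have d2 : d <= e / 32 by rewrite /d ge_min lexx orbT.
  have dd : d * d <= d := ler_piMl (ltW d0) d1.
  rewrite mulr1n [leLHS](_ : _ = d * d / 2); last by field.
  lra.
have [K0 hK] := spanned_expsum p a0 (divr_gt0 e0 (ltr0Sn R 7)).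
exists K0 => K /hK {}hK.
have -> : f = (fun x => expsum p x + ((f x - fn x) + ((fn x - g x) + (g x - expsum p x)))).
  by apply/funext => x; ring.
have h1 : L2 (fun x => f x - fn x) by exact: L2B.
have h2 : L2 (fun x => fn x - g x) by exact: L2B.
have h3 := L2D h2 hgp; have h4 := L2D h1 h3.
apply: le_trans (defectD _ a0 hE h4) _.
have := defect_le K (fun x => (f x - fn x) + ((fn x - g x) + (g x - expsum p x))) a0.
have := ipD_le h1 h3; have := ipD_le h2 hgp.
by lra.
Qed.

End Density.

(** * Smooth cutoff functions *)

Section Cutoffs.
Context {R : realType}.
Implicit Types (c d e x y : R) (n m k : nat) (f g u v : R -> R) (p : {poly R}).
Local Notation mu := (@lebesgue_measure R).
Local Notation D := (`]0, +oo[%classic : set R).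

(** x^(-k) e^(-1/x) on the positive half-line. Allowing every k makes this family of flat
    functions stable under derivation up to linear combinations, so that smoothness at 0 needs
    no separate argument for each derivative. *)
Definition flat_exp k x : R := if 0 < x then exp_poly 1 'X^k x^-1 else 0.

Lemma flat_exp_ge0 k x : 0 <= flat_exp k x.
Proof.
rewrite /flat_exp; case: ifPn => // x0.
by rewrite /exp_poly hornerXn mulr_ge0 ?expR_ge0// exprn_ge0// invr_ge0 ltW.
Qed.

Lemma flat_exp_le k x : flat_exp k x <= k`!%:R.
Proof.
rewrite /flat_exp; case: ifPn => [x0|_]; last by rewrite ler0n.
rewrite /exp_poly hornerXn mul1r expRN ler_pdivrMr ?expR_gt0//.
have w0 : 0 <= x^-1 by rewrite invr_ge0 ltW.
move: (x^-1) w0 => w w0.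
case: k => [|k]; first by rewrite expr0 fact0 mul1r -expR0 ler_expR.
have := expR_ge1Dxn k w0 => h.
rewrite -ler_pdivrMl ?ltr0n ?fact_gt0// mulrC; lra.
Qed.

Lemma flat_exp_mul k x : x * flat_exp k.+1 x = flat_exp k x.
Proof.
rewrite /flat_exp; case: ifPn => [x0|_]; last by rewrite mulr0.
by rewrite /exp_poly !hornerXn exprS !mulrA mulfV ?mul1r// gt_eqF.
Qed.

Lemma is_derive_zero_sq f C : f 0 = 0 -> (forall h, `|f h| <= C * h ^+ 2) -> is_derive (0:R) 1 f 0.
Proof.
move=> f0 fC.
have C0 : 0 <= C by have := fC 1; rewrite expr1n mulr1; apply: le_trans.
have L : h^-1 *: ((f \o shift 0) (h *: (1:R)) - f 0) @[h --> 0^'] --> (0:R).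
  apply/cvgrPdist_lt => e e0; near=> h.
  have h0 : h != 0 by near: h; exact: nbhs_dnbhs_neq.
  rewrite /= f0 subr0 sub0r normrN /shift /= addr0 [h *: 1]mulr1 normrM normfV.
  rewrite mulrC ltr_pdivrMr ?normr_gt0//.
  apply: le_lt_trans (fC h) _.
  rewrite -(real_normK (num_real h)) expr2 mulrA ltr_pM2r ?normr_gt0//.
  have : `|h| < e / (C + 1).
    near: h; apply: dnbhs0_lt; rewrite divr_gt0//.
    by rewrite ltr_wpDl.
  rewrite ltr_pdivlMr ?ltr_wpDl//; have := normr_ge0 h; nra.
by apply: DeriveDef; [exact: cvgP L|exact: cvg_lim L].
Unshelve. all: by end_near. Qed.

(** At 0 the function is O(h^2), because it is h^2 times a bounded member of the same family. *)
Lemma is_derive_flat_exp k x : is_derive x 1 (flat_exp k) (flat_exp k.+2 x - k%:R * flat_exp k.+1 x).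
Proof.
have [x0|x0|->] := ltgtP x 0.
- have e0 j : flat_exp j x = 0 by rewrite /flat_exp (lt_gtF x0).
  rewrite !e0 mulr0 subr0; apply: (@near_eq_is_derive _ _ _ (cst 0)).
    near=> y; rewrite /flat_exp lt_gtF//.
    by near: y; exact: lt_nbhsl.
- apply: (@near_eq_is_derive _ _ _ (exp_poly 1 'X^k \o (fun y => y^-1))).
    near=> y; rewrite /flat_exp ifT//.
    by near: y; exact: lt_nbhsr.
  have x1 : id x != 0 by rewrite /= gt_eqF.
  have di := is_deriveV x1 (@is_derive_id _ _ x 1).
  apply: (is_derive_eq (@is_derive1_comp _ (exp_poly 1 'X^k) (fun y => y^-1) x _ _ (is_derive_exp_poly 1 'X^k x^-1) di)).
  rewrite /flat_exp x0 /exp_poly derivXn scale1r hornerD hornerN hornerMn !hornerXn /GRing.scale /= mulr1.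
  rewrite -exprVn; move: (x^-1) => w; case: k => [|k] /=.
    by rewrite mulr0n !expr0 !mul0r subr0; ring.
  by rewrite -mulr_natl !exprS; ring.
have e0 j : flat_exp j (0:R) = 0 by rewrite /flat_exp ltxx.
rewrite !e0 mulr0 subr0; apply: (@is_derive_zero_sq _ k.+2`!%:R) => // h.
rewrite -flat_exp_mul -flat_exp_mul mulrA -expr2 normrM ger0_norm ?sqr_ge0// mulrC.
by rewrite ler_wpM2r ?sqr_ge0// ger0_norm ?flat_exp_ge0// flat_exp_le.
Unshelve. all: by end_near. Qed.

Lemma flat_exp_cvg k (y : nat -> R) : y n @[n --> \oo] --> +oo ->
  flat_exp k (y n) @[n --> \oo] --> ((k == 0%N)%:R : R).
Proof.
move=> yoo.
have y0 : \forall n \near \oo, 0 < y n by move/cvgryPgt : yoo; exact.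
have yV : (y n)^-1 @[n --> \oo] --> (0:R) by apply/gtr0_cvgV0.
have H : exp_poly 1 'X^k (y n)^-1 @[n --> \oo] --> exp_poly 1 'X^k (0:R).
  by apply: (cvg_comp _ _ yV); exact: continuous_exp_poly.
have -> : (k == 0%N)%:R = exp_poly 1 'X^k (0:R).
  by rewrite /exp_poly hornerXn mulr0 oppr0 expR0 mulr1 expr0n.
apply: cvg_trans H; apply: near_eq_cvg; near=> n; rewrite /flat_exp ifT//.
by near: n.
Unshelve. all: by end_near. Qed.

(** A class of functions that contains the derivatives of its members: its members are smooth. *)
Inductive tame : (R -> R) -> Prop :=
| tame_exp_poly c p : tame (exp_poly c p)
| tame_flat_exp k c d : tame (fun x => flat_exp k (c * x + d))
| tame_add f g : tame f -> tame g -> tame (fun x => f x + g x)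
| tame_mul f g : tame f -> tame g -> tame (fun x => f x * g x).

Lemma is_derive_affine_comp f f' c d x : (forall y, is_derive y 1 f (f' y)) ->
  is_derive x 1 (fun x => f (c * x + d)) (c * f' (c * x + d)).
Proof.
move=> df.
have dl : is_derive x 1 (fun y => c * y + d) c.
  have -> : (fun y : R => c * y + d) = horner (c *: 'X + d%:P).
    by apply/funext => y; rewrite hornerD hornerZ hornerX hornerC.
  have := is_derive_poly (c *: 'X + d%:P) x.
  by rewrite derivD derivC addr0 derivZ derivX hornerZ hornerC mulr1.
rewrite mulrC.
exact: (@is_derive1_comp _ f (fun y => c * y + d) x _ _ (df _) dl).
Qed.

Lemma tame_derive f : tame f -> exists2 g, tame g & forall x, is_derive x 1 f (g x).
Proof.
have cst_tame c : tame (fun=> c).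
  have -> : (fun=> c) = exp_poly 0 c%:P by apply/funext => x; rewrite /exp_poly hornerC mul0r oppr0 expR0 mulr1.
  exact: tame_exp_poly.
elim => {f} [c p|k c d|f g _ [f' tf df] _ [g' tg dg]|f g hf [f' tf df] hg [g' tg dg]].
- by exists (exp_poly c (p^`() - c *: p)); [exact: tame_exp_poly|move=> x; exact: is_derive_exp_poly].
- exists (fun x => c * (flat_exp k.+2 (c * x + d) + (- k%:R) * flat_exp k.+1 (c * x + d))).
    apply: tame_mul => //; apply: tame_add; first exact: tame_flat_exp.
    by apply: tame_mul => //; exact: tame_flat_exp.
  move=> x; rewrite mulNr.
  by apply: (@is_derive_affine_comp _ (fun x => flat_exp k.+2 x - k%:R * flat_exp k.+1 x)) => y; exact: is_derive_flat_exp.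
- exists (fun x => f' x + g' x); first exact: tame_add.
  by move=> x; exact: is_deriveD.
- exists (fun x => f x * g' x + g x * f' x).
    by apply: tame_add; apply: tame_mul.
  by move=> x; exact: is_deriveM.
Qed.

Lemma tame_smooth f : tame f -> forall n x, derivable (derive1n n f) x 1.
Proof.
move=> tf n; suff : tame (derive1n n f) by move=> /tame_derive[g _ dg] x; have [] := dg x.
elim: n => [//|n /tame_derive[g tg dg]]; rewrite derive1nS.
rewrite (_ : derive1 _ = g)//; apply/funext => x.
by rewrite derive1E; have [_ ->] := dg x.
Qed.

End Cutoffs.

(** * Integration by parts for weak derivatives *)

Section WeakIntegrationByParts.
Context {R : realType}.
Implicit Types (c d e x y : R) (n m k : nat) (f g u v : R -> R) (p : {poly R}).
Local Notation mu := (@lebesgue_measure R).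
Local Notation D := (`]0, +oo[%classic : set R).

Lemma L2_norm f : L2 f -> L2 (fun x => `|f x|).
Proof.
move=> hf; apply: (@L2_le _ _ f) => //; last by move=> x _; rewrite normr_id.
by apply: measurableT_comp => //; case: hf.
Qed.

(** Smooth, supported in [1 / (m + 1), m + 1], and tending to 1 on the half-line as m grows. At the
    left end it depends on (m + 1) x only, so that x times its derivative stays bounded there
    uniformly in m, see dcutoff_bound. *)
Definition cutoff m x : R := flat_exp 0 (m.+1%:R * x + -1) * flat_exp 0 (-1 * x + m.+1%:R).

Definition dcutoff m x : R :=
  m.+1%:R * flat_exp 2 (m.+1%:R * x + -1) * flat_exp 0 (-1 * x + m.+1%:R) -
  flat_exp 0 (m.+1%:R * x + -1) * flat_exp 2 (-1 * x + m.+1%:R).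

Lemma is_derive_cutoff m x : is_derive x 1 (cutoff m) (dcutoff m x).
Proof.
have de y : is_derive y 1 (@flat_exp R 0) (flat_exp 2 y).
  by apply: (is_derive_eq (is_derive_flat_exp 0 y)); rewrite mul0r subr0.
have dA := is_derive_affine_comp m.+1%:R (-1) x de.
have dB := is_derive_affine_comp (-1) m.+1%:R x de.
apply: (is_derive_eq (is_deriveM dA dB)); rewrite /dcutoff /GRing.scale /=; ring.
Qed.

Lemma cutoff01 m x : 0 <= cutoff m x <= 1.
Proof.
rewrite /cutoff mulr_ge0 ?flat_exp_ge0//= -[leRHS]mulr1 ler_pM ?flat_exp_ge0//;
  by rewrite (le_trans (flat_exp_le _ _))// fact0.
Qed.

Lemma cutoff_support m x : ~ (m.+1%:R^-1 <= x <= m.+1%:R) -> cutoff m x = 0.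
Proof.
move=> h; rewrite /cutoff /flat_exp; case: ltP => [h1|]; last by rewrite mul0r.
case: ltP => [h2|]; last by rewrite mulr0.
exfalso; apply: h; apply/andP; split; last by lra.
by rewrite -[leLHS]mulr1 ler_pdivrMl ?ltr0n//; lra.
Qed.

Lemma dcutoff_bound m x : 0 < x -> `|x * dcutoff m x| <= 3 + 2 * x.
Proof.
move=> x0; set y := m.+1%:R * x + -1.
have e1 : x * dcutoff m x = (y * flat_exp 2 y + flat_exp 2 y) * flat_exp 0 (-1 * x + m.+1%:R) -
   flat_exp 0 y * (x * flat_exp 2 (-1 * x + m.+1%:R)).
  by rewrite /dcutoff -/y /y; ring.
rewrite e1 flat_exp_mul.
have := flat_exp_ge0 0 y; have := flat_exp_le 0 y; have := flat_exp_ge0 1 y; have := flat_exp_le 1 y.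
have := flat_exp_ge0 2 y; have := flat_exp_le 2 y.
set z := -1 * x + m.+1%:R.
have := flat_exp_ge0 0 z; have := flat_exp_le 0 z; have := flat_exp_ge0 2 z; have := flat_exp_le 2 z.
rewrite !factS fact0 !muln1 /=.
move: (flat_exp 0 z) (flat_exp 2 z) (flat_exp 0 y) (flat_exp 1 y) (flat_exp 2 y) => z0 z2 y0 y1 y2.
move=> b1 b2 b3 b4 b5 b6 b7 b8 b9 b10.
have p1 : 0 <= (y1 + y2) * z0 <= 3.
  apply/andP; split; first by rewrite mulr_ge0// addr_ge0.
  by apply: (@le_trans _ _ ((1 + 2) * 1)); [rewrite ler_pM ?addr_ge0 ?lerD|lra].
have p2 : 0 <= y0 * (x * z2) <= 2 * x.
  apply/andP; split; first by rewrite !mulr_ge0// ltW.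
  apply: (@le_trans _ _ (1 * (x * 2))); last by lra.
  by rewrite ler_pM ?mulr_ge0 ?ler_pM2l// ltW.
case/andP: p1 => q1 q2; case/andP: p2 => q3 q4.
by rewrite ler_norml; apply/andP; split; lra.
Qed.

Lemma cvg_pinfty_affine c d : 0 < c -> c * n.+1%:R + d @[n --> \oo] --> +oo.
Proof.
move=> c0; apply/cvgryPge => A; near=> n.
have : ((A - d) / c <= n%:R) by near: n; exact: nbhs_infty_ger.
by rewrite ler_pdivrMr// -natr1 => h; nra.
Unshelve. all: by end_near. Qed.

Lemma cutoff_cvg x : 0 < x -> cutoff m x @[m --> \oo] --> (1:R).
Proof.
move=> x0.
have A : m.+1%:R * x + -1 @[m --> \oo] --> +oo.
  by under eq_fun do rewrite mulrC; exact: cvg_pinfty_affine.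
have B : -1 * x + m.+1%:R @[m --> \oo] --> +oo.
  have := @cvg_pinfty_affine 1 (-1 * x) ltr01.
  by under eq_fun do rewrite mul1r addrC.
have := cvgM (@flat_exp_cvg R 0 _ A) (@flat_exp_cvg R 0 _ B).
by rewrite eqxx mulr1; apply.
Qed.

Lemma dcutoff_cvg x : 0 < x -> x * dcutoff m x @[m --> \oo] --> (0:R).
Proof.
move=> x0.
have A : m.+1%:R * x + -1 @[m --> \oo] --> +oo.
  by under eq_fun do rewrite mulrC; exact: cvg_pinfty_affine.
have B : -1 * x + m.+1%:R @[m --> \oo] --> +oo.
  have := @cvg_pinfty_affine 1 (-1 * x) ltr01.
  by under eq_fun do rewrite mul1r addrC.
rewrite (_ : (fun m => x * dcutoff m x) = (fun m =>
  (flat_exp 1 (m.+1%:R * x + -1) + flat_exp 2 (m.+1%:R * x + -1)) * flat_exp 0 (-1 * x + m.+1%:R) -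
   flat_exp 0 (m.+1%:R * x + -1) * (x * flat_exp 2 (-1 * x + m.+1%:R)))); last first.
  by apply/funext => m; rewrite -(flat_exp_mul 1) /dcutoff; ring.
rewrite (_ : 0 = (0 + 0) * 1 - 1 * (x * 0)); last by ring.
apply: cvgB; apply: cvgM; [apply: cvgD| |..|apply: cvgM; first exact: cvg_cst].
- exact: (@flat_exp_cvg R 1 _ A).
- exact: (@flat_exp_cvg R 2 _ A).
- exact: (@flat_exp_cvg R 0 _ B).
- exact: (@flat_exp_cvg R 0 _ A).
- exact: (@flat_exp_cvg R 2 _ B).
Qed.

Lemma tame_cutoff m : tame (cutoff m).
Proof. by apply: tame_mul; exact: tame_flat_exp. Qed.

Lemma test_function_cutoff m c p : test_function (fun x => cutoff m x * exp_poly c p x).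
Proof.
split.
  by apply: tame_smooth; apply: tame_mul; [exact: tame_cutoff|exact: tame_exp_poly].
exists m.+1%:R^-1, m.+1%:R; split; first by rewrite invr_gt0 ltr0n.
by move=> x h; rewrite cutoff_support// mul0r.
Qed.

(** Integration by parts against x p(x) e^(-c x), which is not a test function. Test with its
    product by cutoff m instead and let m grow: thanks to the factor x, the term with the
    derivative of the cutoff stays dominated and tends to 0, so that no boundary value of u at 0
    appears. *)
Lemma weak_integration_by_parts u v c p : 0 < c -> weak_derivative u v -> L2 u -> L2 v ->
  L2 (fun x => x * v x) ->
  ip u (exp_poly c (('X * p)^`() - c *: ('X * p))) = - ip (fun x => x * v x) (exp_poly c p).
Proof.
move=> c0 [_ _ wd] hu hv hxv.
set q := _ - _; pose W := exp_poly c ('X * p).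
have WE x : W x = x * exp_poly c p x by rewrite /W /exp_poly hornerM hornerX mulrA.
have dW x : is_derive x 1 W (exp_poly c q x) by exact: is_derive_exp_poly.
pose phi m x := cutoff m x * W x.
have dphi m x : derive1 (phi m) x = dcutoff m x * W x + cutoff m x * exp_poly c q x.
  rewrite derive1E; have [_ ->] := is_deriveM (is_derive_cutoff m x) (dW x).
  by rewrite /GRing.scale /=; ring.
have mW : measurable_fun D W by exact: measurable_exp_poly.
have mq : measurable_fun D (exp_poly c q) by exact: measurable_exp_poly.
have [mu_ _] := hu; have [mv _] := hv.
have mcut m : measurable_fun D (cutoff m).
  apply: measurable_funTS; apply: continuous_measurable_fun => x.
  apply: differentiable_continuous; apply/derivable1_diffP.
  by have [] := is_derive_cutoff m x.
have mdcut m : measurable_fun D (dcutoff m).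
  apply: measurable_funTS; apply: continuous_measurable_fun => x.
  have [g tg dg] := tame_derive (tame_cutoff m).
  have -> : dcutoff m = g.
    by apply/funext => y; have [_ <-] := is_derive_cutoff m y; have [_ <-] := dg y.
  have [h _ dh] := tame_derive tg.
  apply: differentiable_continuous; apply/derivable1_diffP.
  by have [] := dh x.
have L : \int[mu]_(x in D) (u x * derive1 (phi m) x) @[m --> \oo] --> \int[mu]_(x in D) (u x * exp_poly c q x).
  pose G x := `|u x| * (3 * `|exp_poly c p x| + 2 * `|W x| + `|exp_poly c q x|).
  have [] := @Rintegral_dominated_cvg R D (fun m x => u x * derive1 (phi m) x)
    (fun x => u x * exp_poly c q x) G.
  - exact: measurable_D.
  - move=> m; apply: measurable_funM => //.
    rewrite (funext (dphi m)).
    by apply: measurable_funD; apply: measurable_funM.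
  - move=> x /=; rewrite in_itv /= andbT => x0.
    rewrite (_ : (fun m => _) =
      (fun m => u x * (x * dcutoff m x * exp_poly c p x + cutoff m x * exp_poly c q x))); last first.
      by apply/funext => m; rewrite dphi WE; ring.
    rewrite (_ : u x * exp_poly c q x = u x * (0 * exp_poly c p x + 1 * exp_poly c q x)); last by ring.
    apply: cvgM; first exact: cvg_cst.
    apply: cvgD; apply: cvgM; [exact: dcutoff_cvg|exact: cvg_cst|exact: cutoff_cvg|exact: cvg_cst].
  - have hG : L2 (fun x => 3 * `|exp_poly c p x| + 2 * `|W x| + `|exp_poly c q x|).
      by do ![apply: L2D|apply: L2Z|apply: L2_norm]; exact: L2_exp_poly.
    exact: integrable_mul (L2_norm hu) hG.
  - move=> m x /=; rewrite in_itv /= andbT => x0.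
    rewrite normrM ler_wpM2l// dphi (le_trans (ler_normD _ _))// lerD//.
      rewrite WE mulrA (mulrC _ x) normrM [`|x * exp_poly c p x|]normrM (gtr0_norm x0).
      have := dcutoff_bound m x0; have := normr_ge0 (exp_poly c p x); nra.
    have /andP[t0 t1] := cutoff01 m x; rewrite (normrM (cutoff m x)) (ger0_norm t0).
    by rewrite ler_piMl.
  by move=> _.
have Rl : \int[mu]_(x in D) (v x * phi m x) @[m --> \oo] --> \int[mu]_(x in D) (x * v x * exp_poly c p x).
  have [] := @Rintegral_dominated_cvg R D (fun m x => v x * phi m x)
    (fun x => x * v x * exp_poly c p x) (fun x => `|x * v x| * `|exp_poly c p x|).
  - exact: measurable_D.
  - by move=> m; apply: measurable_funM => //; apply: measurable_funM.
  - move=> x /=; rewrite in_itv /= andbT => x0; rewrite /phi.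
    rewrite (_ : (fun m => _) = (fun m => cutoff m x * (x * v x * exp_poly c p x))); last first.
      by apply/funext => m; rewrite WE; ring.
    suff: cutoff m x * (x * v x * exp_poly c p x) @[m --> \oo] --> 1 * (x * v x * exp_poly c p x).
      by rewrite mul1r.
    by apply: cvgM; [exact: cutoff_cvg|exact: cvg_cst].
  - by apply: integrable_mul; apply: L2_norm => //; exact: L2_exp_poly.
  - move=> m x _; rewrite -normrM /phi WE.
    rewrite (_ : v x * _ = cutoff m x * (x * v x * exp_poly c p x)); last by ring.
    have /andP[t0 t1] := cutoff01 m x; rewrite (normrM (cutoff m x)) (ger0_norm t0).
    by rewrite ler_piMl.
  by move=> _.
have eqm m : \int[mu]_(x in D) (u x * derive1 (phi m) x) = - \int[mu]_(x in D) (v x * phi m x).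
  by apply: wd; exact: test_function_cutoff.
have L' : \int[mu]_(x in D) (u x * derive1 (phi m) x) @[m --> \oo] --> - \int[mu]_(x in D) (x * v x * exp_poly c p x).
  by under eq_fun do rewrite eqm; apply: (@cvgN _ R^o).
exact: (@cvg_unique _ (@Rhausdorff R) _ _ _ _ L L').
Qed.

End WeakIntegrationByParts.

(** * Decay of the Laguerre coefficients *)

Section SpectralDecay.
Context {R : realType}.
Implicit Types (a c e x y : R) (n m k N : nat) (f g u v : R -> R) (p q : {poly R}).

Lemma sum_nat_le (u : nat -> R) m n : (m <= n)%N -> (forall i, 0 <= u i) ->
  \sum_(i < m) u i <= \sum_(i < n) u i.
Proof.
move=> mn u0; rewrite -(subnKC mn) big_split_ord /= lerDl.
by apply: sumr_ge0.
Qed.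

(** In the sum of g n * k n the products g n * g n.+1 telescope, which leaves the boundary term. *)
Lemma hardy_partial_sum (g k : nat -> R) N :
  (forall n, k n = - (2^-1 * (g n + n.+1%:R * g n.+1 - n%:R * g n.-1))) ->
  \sum_(n < N) g n ^+ 2 <= 4 * \sum_(n < N) k n ^+ 2 + 2 * N%:R * `|g N.-1 * g N|.
Proof.
move=> hk.
have tele : \sum_(n < N) g n * k n = - (2^-1 * (\sum_(n < N) g n ^+ 2 + N%:R * (g N.-1 * g N))).
  elim: N => [|N IH]; first by rewrite !big_ord0 mul0r addr0 mulr0 oppr0.
  by rewrite !big_ord_recr /= IH hk; ring.
have amgm : - \sum_(n < N) g n * k n <= 4^-1 * \sum_(n < N) g n ^+ 2 + \sum_(n < N) k n ^+ 2.
  rewrite -sumrN mulr_sumr -big_split /=; apply: ler_sum => n _.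
  have : 0 <= (2^-1 * g n + k n) ^+ 2 by exact: sqr_ge0.
  by rewrite sqrrD exprMn; nra.
have := ler_norm (- (g N.-1 * g N)); rewrite normrN => h.
have N0 : 0 <= N%:R :> R by rewrite ler0n.
have := ler_wpM2l N0 h.
by move: amgm; rewrite tele; lra.
Qed.

(** The discrete form of the Hardy inequality |u| <= 2 |x u'|. If it failed by d > 0, the
    boundary term of hardy_partial_sum would give g (N-1)^2 + g N^2 >= d / N for all large N, and
    the harmonic series would contradict the summability of g n ^+ 2; below, each passage from M
    to 2 M + 1 adds at least d / 4 to the partial sums. *)
Lemma l2_hardy (g k : nat -> R) (S G : R) :
  (forall n, k n = - (2^-1 * (g n + n.+1%:R * g n.+1 - n%:R * g n.-1))) ->
  (forall N, \sum_(n < N) k n ^+ 2 <= S) -> (forall N, \sum_(n < N) g n ^+ 2 <= G) ->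
  forall N, \sum_(n < N) g n ^+ 2 <= 4 * S.
Proof.
move=> hk hS hG N0; rewrite leNgt; apply/negP => h.
set d := \sum_(n < N0) g n ^+ 2 - 4 * S.
have d0 : 0 < d by rewrite /d subr_gt0.
pose T M := \sum_(n < M) g n ^+ 2.
have g2 i : 0 <= g i ^+ 2 by exact: sqr_ge0.
(* with boundary index M + i + 1 <= 2 M *)
have pair M i : (N0 <= M)%N -> (0 < M)%N -> (i < M)%N ->
    d / (2 * M%:R) <= g (M + i)%N ^+ 2 + g (M + i).+1 ^+ 2.
  move=> NM M0 iM; have := hardy_partial_sum (M + i).+1 hk => /=.
  have := hS (M + i).+1.
  have := @sum_nat_le (fun n => g n ^+ 2) N0 (M + i).+1 _ g2.
  rewrite (leq_trans NM) ?(leq_trans (leq_addr i M))// => /(_ isT) h1 h2 h3.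
  have h4 : d <= 2 * (M + i).+1%:R * `|g (M + i)%N * g (M + i).+1| by rewrite /d; lra.
  have h5 : 2 * `|g (M + i)%N * g (M + i).+1| <= g (M + i)%N ^+ 2 + g (M + i).+1 ^+ 2.
    rewrite normrM -[g (M + i)%N ^+ 2]real_normK ?num_real// -[g (M + i).+1 ^+ 2]real_normK ?num_real//.
    by have := sqr_ge0 (`|g (M + i)%N| - `|g (M + i).+1|); rewrite sqrrB; lra.
  have h6 : (M + i).+1%:R <= 2 * M%:R :> R.
    by rewrite -natrM ler_nat mul2n -addnn -addnS leq_add2l.
  have M1 : 0 < 2 * M%:R :> R by rewrite mulr_gt0 ?ltr0n.
  rewrite ler_pdivrMr//; apply: le_trans h4 _.
  rewrite mulrAC mulrC mulrC.
  have := normr_ge0 (g (M + i)%N * g (M + i).+1).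
  move: (`|g (M + i)%N * g (M + i).+1|) h5 => w h5 w0.
  apply: (@le_trans _ _ ((2 * w) * (2 * M%:R))); last by rewrite ler_wpM2r// ltW.
  by rewrite ler_wpM2l// mulr_ge0.
have step M : (N0 <= M)%N -> (0 < M)%N -> T M + d / 4 <= T (M + M).+1.
  move=> NM M0.
  have h1 : \sum_(i < M) d / (2 * M%:R) <= \sum_(i < M) (g (M + i)%N ^+ 2 + g (M + i).+1 ^+ 2).
    by apply: ler_sum => i _; exact: pair.
  rewrite sumr_const card_ord big_split /= in h1.
  have e1 : \sum_(i < M) g (M + i)%N ^+ 2 = T (M + M)%N - T M.
    by rewrite /T big_split_ord /= addrAC subrr add0r.
  have e2 : \sum_(i < M) g (M + i).+1 ^+ 2 = T (M + M).+1 - T M.+1.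
    rewrite /T -addSn big_split_ord /= addrAC subrr add0r.
    by apply: eq_bigr => i _; rewrite addSn.
  have e3 : T (M + M)%N <= T (M + M).+1 by apply: (@sum_nat_le (fun n => g n ^+ 2)).
  have e4 : T M <= T M.+1 by apply: (@sum_nat_le (fun n => g n ^+ 2)).
  have e5 : d / (2 * M%:R) *+ M = d / 2.
    by rewrite -mulr_natr; field; rewrite pnatr_eq0 -lt0n.
  by rewrite e1 e2 e5 in h1; lra.
have grow j : exists M, [/\ (N0 <= M)%N, (0 < M)%N & j%:R * (d / 4) <= T M].
  elim: j => [|j [M [h1 h2 h3]]].
    by exists N0.+1; split => //; rewrite mul0r; apply: sumr_ge0.
  exists (M + M).+1; split => //; first by rewrite (leq_trans h1)// -addSn leq_addl.
  rewrite -[j.+1%:R]natr1 mulrDl mul1r; apply: le_trans (step M h1 h2).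
  by rewrite lerD2r.
have d4 : 0 < d / 4 by rewrite divr_gt0.
have Gd : 0 <= `|G| / (d / 4) by rewrite divr_ge0 ?(ltW d4).
have [M [_ _ hM]] := grow (Num.Def.archi_bound (`|G| / (d / 4))).
have := archi_boundP Gd; rewrite ltr_pdivrMr// => hb.
have := hG M; have := ler_norm G; rewrite -/(T M); lra.
Qed.

Lemma exp_polyD c p q x : exp_poly c (p + q) x = exp_poly c p x + exp_poly c q x.
Proof. by rewrite /exp_poly hornerD mulrDl. Qed.

Lemma exp_polyZ c e p x : exp_poly c (e *: p) x = e * exp_poly c p x.
Proof. by rewrite /exp_poly hornerZ mulrA. Qed.

Lemma exp_polyX c p x : exp_poly c ('X * p) x = x * exp_poly c p x.
Proof. by rewrite /exp_poly hornerM hornerX mulrA. Qed.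

Lemma ip_exp_polyD f c p q : 0 < c -> L2 f -> ip f (exp_poly c (p + q)) = ip f (exp_poly c p) + ip f (exp_poly c q).
Proof.
move=> c0 hf; rewrite -ipDr//; [|exact: L2_exp_poly..].
by apply: eq_ip => x _; rewrite exp_polyD.
Qed.

Lemma ip_exp_polyZ f c e p : 0 < c -> L2 f -> ip f (exp_poly c (e *: p)) = e * ip f (exp_poly c p).
Proof.
move=> c0 hf; rewrite -ipZr//; last exact: L2_exp_poly.
by apply: eq_ip => x _; rewrite exp_polyZ.
Qed.

Lemma ip_exp_polyX f c p : ip (fun x => x * f x) (exp_poly c p) = ip f (exp_poly c ('X * p)).
Proof. by apply: eq_ip => x _; rewrite exp_polyX; ring. Qed.

(** Pair u with laguerre_dilation and integrate by parts. *)
Lemma laguerre_coef_dilation a u v n : 0 < a -> weak_derivative u v -> L2 u -> L2 v ->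
  L2 (fun x => x * v x) ->
  laguerre_coef a (fun x => x * v x) n =
  - (2^-1 * (laguerre_coef a u n + n.+1%:R * laguerre_coef a u n.+1 - n%:R * laguerre_coef a u n.-1)).
Proof.
move=> a0 wd hu hv hxv.
have := weak_integration_by_parts (laguerre a n) a0 wd hu hv hxv.
rewrite -/(laguerre_fun a n) -/(laguerre_coef a _ n) => /eqP; rewrite -eqr_oppLR => /eqP <-.
congr (- _).
have -> : ('X * laguerre a n)^`() - a *: ('X * laguerre a n) =
    2^-1 *: (laguerre a n + n.+1%:R *: laguerre a n.+1 + (- n%:R) *: laguerre a n.-1).
  rewrite scaleNr -laguerre_dilation scalerA mulVf ?scale1r//.
  by rewrite derivM derivX mul1r.
by rewrite ip_exp_polyZ// !ip_exp_polyD// !ip_exp_polyZ// mulNr.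
Qed.

(** The Laguerre functions are eigenfunctions of u |-> x u'' + u' - a^2 x u, by laguerre_ode. Two
    integrations by parts move this operator to f. *)
Lemma laguerre_coef_operator a f fx fxx n : 0 < a -> weak_derivative f fx -> weak_derivative fx fxx ->
  L2 f -> L2 fx -> L2 fxx -> L2 (fun x => x * f x) -> L2 (fun x => x * fx x) ->
  L2 (fun x => x * fxx x) ->
  2 * a * (n%:R + 2^-1) * laguerre_coef a f n =
  a ^+ 2 * laguerre_coef a (fun x => x * f x) n - laguerre_coef a fx n - laguerre_coef a (fun x => x * fxx x) n.
Proof.
move=> a0 w1 w2 hf hfx hfxx hxf hxfx hxfxx.
pose p := laguerre a n; pose q := p^`() - a *: p.
have e1 := weak_integration_by_parts p a0 w2 hfx hfxx hxfxx.
have e2 := weak_integration_by_parts q a0 w1 hf hfx hxfx.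
have r1 : ('X * p)^`() - a *: ('X * p) = p + 'X * q.
  by rewrite derivM derivX mul1r /q mulrBr -scalerAr addrA.
have r2 : ('X * q)^`() - a *: ('X * q) = (- (2 * a * (n%:R + 2^-1))) *: p + a ^+ 2 *: ('X * p).
  have ode := laguerre_ode a n; rewrite -/p in ode.
  have -> : - (2 * a * (n%:R + 2^-1)) = - (2 * a * n%:R) - a by field.
  rewrite scalerBl -ode derivM derivX mul1r /q derivB derivZ -!mul_polyC.
  by rewrite polyCM polyCMn expr2 polyCM; ring.
rewrite r1 ip_exp_polyD// -ip_exp_polyX in e1.
rewrite r2 ip_exp_polyD// !ip_exp_polyZ// -ip_exp_polyX in e2.
rewrite /laguerre_coef /laguerre_fun -/p; lra.
Qed.

(** laguerre_coef_operator and the Bessel inequality; the coefficients of fx, over which x fxx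
    gives no direct control, are bounded by l2_hardy. *)
Lemma laguerre_coef_decay a f fx fxx N : 0 < a -> weak_derivative f fx -> weak_derivative fx fxx ->
  L2 f -> L2 fx -> L2 fxx -> L2 (fun x => x * f x) -> L2 (fun x => x * fx x) ->
  L2 (fun x => x * fxx x) ->
  2 * a * \sum_(n < N) (2 * a * (n%:R + 2^-1) * laguerre_coef a f n) ^+ 2 <=
  3 * (a ^+ 4 * ip (fun x => x * f x) (fun x => x * f x) +
       5 * ip (fun x => x * fxx x) (fun x => x * fxx x)).
Proof.
move=> a0 w1 w2 hf hfx hfxx hxf hxfx hxfxx.
have a20 : 0 < 2 * a by rewrite mulr_gt0.
set A := ip _ _; set B := ip _ _.
have bt := bessel N a0 hxf; have bk K := bessel K a0 hxfxx; have bg K := bessel K a0 hfx.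
have hardy : 2 * a * \sum_(n < N) laguerre_coef a fx n ^+ 2 <= 4 * B.
  have := @l2_hardy (laguerre_coef a fx) (laguerre_coef a (fun x => x * fxx x)) (B / (2 * a)) (ip fx fx / (2 * a)).
  move=> /(_ _ _ _ N) h; rewrite -ler_pdivlMl// mulrC -mulrA; apply: h.
  - by move=> n; exact: laguerre_coef_dilation.
  - by move=> K; rewrite ler_pdivlMr// mulrC; exact: bk.
  - by move=> K; rewrite ler_pdivlMr// mulrC; exact: bg.
have : \sum_(n < N) (2 * a * (n%:R + 2^-1) * laguerre_coef a f n) ^+ 2 <=
  3 * (a ^+ 4 * \sum_(n < N) laguerre_coef a (fun x => x * f x) n ^+ 2 + \sum_(n < N) laguerre_coef a fx n ^+ 2
    + \sum_(n < N) laguerre_coef a (fun x => x * fxx x) n ^+ 2).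
  rewrite mulr_sumr -!big_split mulr_sumr /=; apply: ler_sum => n _.
  rewrite (laguerre_coef_operator n a0 w1 w2)//.
  move: (laguerre_coef a _ n) (laguerre_coef a _ n) (laguerre_coef a _ n) => k g t.
  have -> : a ^+ 4 * t ^+ 2 = (a ^+ 2 * t) ^+ 2 by rewrite exprMn -exprM.
  move: (a ^+ 2 * t) => {}t.
  have := sqr_ge0 (t + g); have := sqr_ge0 (t + k); have := sqr_ge0 (g - k).
  by rewrite !expr2; lra.
move=> /(ler_wpM2l (ltW a20)) h; apply: le_trans h _.
have bk' := bk N.
have a4 : 0 <= a ^+ 4 by rewrite exprn_ge0// ltW.
have := ler_wpM2l a4 bt; rewrite -/A -/B in bk' *.
move: (\sum_(n < N) _) hardy bk' => s1 hardy; move: (\sum_(n < N) _) => s2 bk'.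
move: (\sum_(n < N) _) => s3 h.
lra.
Qed.

End SpectralDecay.

(** * Coefficients of a polynomial from its values *)

Section Interpolation.
Context {R : realType}.
Implicit Types (e d B : R) (n m i j : nat) (p : {poly R}).

Lemma prod_dist_left i : (\prod_(0 <= j < i) (i - j) = i`!)%N.
Proof.
elim: i => [|i IH]; first by rewrite big_geq.
by rewrite big_nat_recl// subn0 factS -IH; congr (_ * _)%N; apply: eq_bigr => j _; rewrite subSS.
Qed.

Lemma prod_dist_right i m : (\prod_(i.+1 <= j < i.+1 + m) (j - i) = m`!)%N.
Proof.
elim: m => [|m IH]; first by rewrite addn0 big_geq.
rewrite addnS big_nat_recr/=; last by rewrite leq_addr.
by rewrite IH factS mulnC addSnnS addKn.
Qed.

(** The factors with j < i multiply to i!, those with j > i to (n - 1 - i)!. *)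
Lemma prod_dist n i : (i < n)%N ->
  (\prod_(j < n | (j : nat) != i) ((i - j) + (j - i)) = i`! * (n - i.+1)`!)%N.
Proof.
move=> ni; rewrite -(big_mkord (fun j => j != i) (fun j => ((i - j) + (j - i))%N)).
rewrite (big_cat_nat (leq0n i) (ltnW ni)) /= (big_cat_nat (leqnSn i) ni) /=.
have -> : (\prod_(i <= j < i.+1 | j != i) ((i - j) + (j - i)) = 1)%N.
  by rewrite big_mkcond big_nat1 eqxx.
rewrite mul1n; congr (_ * _)%N.
  rewrite -prod_dist_left big_nat_cond [RHS]big_nat_cond; apply: eq_big => j.
    by rewrite andbT andb_idr// => /andP[_ /ltn_eqF ->].
  by case/andP => /andP[_ ji] _; rewrite (eqP (ltnW ji)) addn0.
rewrite -{1}(subnKC ni) -(prod_dist_right i) big_nat_cond [RHS]big_nat_cond; apply: eq_big => j.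
  by rewrite andbT andb_idr// => /andP[/gtn_eqF ->].
by case/andP => /andP[ij _] _; rewrite (eqP (ltnW ij)) add0n.
Qed.

(** By induction: each factor of degree one multiplies the weighted sup-norm of the coefficients
    by at most 2 e. *)
Lemma coef_prod_bound (I : Type) (r : seq I) (P : pred I) (x : I -> R) e m : 0 < e ->
  (forall k, P k -> `|x k| <= e) ->
  `|(\prod_(k <- r | P k) ('X - (x k)%:P))`_m| * e ^+ m <= (2 * e) ^+ count P r.
Proof.
move=> e0 hx; elim: r m => [|k r IH] m.
  rewrite big_nil coef1 /= expr0; case: m => [|m]; first by rewrite normr1 mul1r.
  by rewrite normr0 mul0r.
rewrite big_cons /=; case: ifPn => Pi; last by rewrite add0n.
rewrite add1n exprS mulrBl coefB coefXM coefCM.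
have h1 := IH m.
have h2 : `|if m == 0%N then 0 else (\prod_(k <- r | P k) ('X - (x k)%:P))`_m.-1| * e ^+ m
    <= e * (2 * e) ^+ count P r.
  case: m {h1} => [|m] /=.
    by rewrite normr0 mul0r mulr_ge0 ?exprn_ge0 ?mulr_ge0// ltW.
  by rewrite exprS mulrCA ler_wpM2l// ltW.
have h3 : `|x k * (\prod_(k <- r | P k) ('X - (x k)%:P))`_m| * e ^+ m
    <= e * (2 * e) ^+ count P r.
  by rewrite normrM -mulrA ler_pM ?mulr_ge0 ?exprn_ge0 ?(ltW e0) ?hx.
apply: (@le_trans _ _ ((`|if m == 0%N then 0 else (\prod_(k <- r | P k) ('X - (x k)%:P))`_m.-1|
   + `|x k * (\prod_(k <- r | P k) ('X - (x k)%:P))`_m|) * e ^+ m)).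
  by apply: ler_wpM2r; [rewrite exprn_ge0// ltW|exact: ler_normB].
by rewrite mulrDl; lra.
Qed.

(** Lagrange interpolation. At the i-th node the denominator is at least d^K i! (K - i)!, hence at
    least d^K K! / 2^K, and coef_prod_bound controls the numerator. *)
Lemma interpolation_coef_bound K (P : {poly R}) (z : nat -> R) e d B m :
  0 < e -> 0 < d -> (size P <= K.+1)%N ->
  (forall i, (i <= K)%N -> 0 <= z i <= e) ->
  (forall i j, (i <= K)%N -> (j <= K)%N -> ((i - j) + (j - i))%N%:R * d <= `|z i - z j|) ->
  (forall i, (i <= K)%N -> `|P.[z i]| <= B) ->
  `|P`_m| * e ^+ m <= K.+1%:R * (B * ((4 * e / d) ^+ K / K`!%:R)).
Proof.
move=> e0 d0 sP hz hd hB.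
(* lagrange_gen wants nodes that are injective on all of nat *)
pose x i := if (i <= K)%N then z i else e + i%:R.
have xz i : (i <= K)%N -> x i = z i by move=> iK; rewrite /x iK.
have xinj : injective x.
  move=> i j; rewrite /x; case: leqP => iK; case: leqP => jK; last first.
  - by move/addrI/eqP; rewrite eqr_nat => /eqP.
  - have /andP[_ h] := hz j jK; have i0 : 0 < i%:R :> R by rewrite ltr0n (leq_trans _ iK).
    by move=> h'; exfalso; lra.
  - have /andP[_ h] := hz i iK; have j0 : 0 < j%:R :> R by rewrite ltr0n (leq_trans _ jK).
    by move=> h'; exfalso; lra.
  move=> zz; have := hd i j iK jK; rewrite zz subrr normr0.
  rewrite pmulr_lle0// (ler_nat R _ 0) leqn0 addn_eq0 !subn_eq0 => h.
  by apply/eqP; rewrite eqn_leq.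
have K0 : (0 < K.+1)%N by [].
rewrite (lagrange_gen K0 xinj sP) coef_sum.
apply: (@le_trans _ _ (\sum_(i < K.+1) B * ((4 * e / d) ^+ K / K`!%:R))); last first.
  by rewrite sumr_const card_ord (mulr_natl _ K.+1).
apply: (@le_trans _ _ (\sum_(i < K.+1)
   `|(P.[x i]%:P * tnth (K.+1.-lagrange x) i)`_m| * e ^+ m)).
  rewrite -mulr_suml; apply: ler_wpM2r; last exact: ler_norm_sum.
  by rewrite exprn_ge0// ltW.
apply: ler_sum => i _.
have iK : (i <= K)%N by rewrite -ltnS.
rewrite coefCM normrM -[leLHS]mulrA; apply: ler_pM => //.
- by rewrite mulr_ge0// exprn_ge0// ltW.
- by rewrite xz// hB.
rewrite lagrangeE//= coefCM normrM normfV -[leLHS]mulrA.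
have cnt : count (fun j : 'I_K.+1 => (j != i)) (index_enum 'I_K.+1) = K.
  have := cardC1 i; rewrite card_ord /= => e1; rewrite -[RHS]e1 -sum1_count -sum1_card.
  by apply: eq_bigl => j.
have hc := @coef_prod_bound 'I_K.+1 (index_enum 'I_K.+1) (fun j : 'I_K.+1 => j != i) (fun j : 'I_K.+1 => x j) e m e0.
rewrite cnt in hc.
have {}hc : `|(\prod_(j < K.+1 | j != i) ('X - (x j)%:P))`_m| * e ^+ m <= (2 * e) ^+ K.
  apply: hc => j _; have jK : (j <= K)%N by rewrite -ltnS.
  by rewrite xz//; have /andP[h1 h2] := hz j jK; rewrite ger0_norm.
have D : d ^+ K * (i`! * (K - i)`!)%:R <= `|(\prod_(j < K.+1 | j != i) ('X - (x j)%:P)).[x i]|.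
  have -> : (i`! * (K - i)`!)%N = (i`! * (K.+1 - i.+1)`!)%N by rewrite subSS.
  rewrite -prod_dist// natr_prod horner_prod normr_prod.
  rewrite (_ : d ^+ K = \prod_(j < K.+1 | j != i) d); last first.
    by rewrite big_const_seq cnt -Monoid.iteropE.
  rewrite -big_split /=; apply: ler_prod => j _; rewrite hornerXsubC !xz//; last by rewrite -ltnS.
  rewrite mulr_ge0 ?ler0n ?(ltW d0)//= mulrC.
  by apply: hd => //; rewrite -ltnS.
have f0 : 0 < d ^+ K * (i`! * (K - i)`!)%:R.
  by rewrite mulr_gt0 ?exprn_gt0// ltr0n muln_gt0 !fact_gt0.
apply: (@le_trans _ _ ((d ^+ K * (i`! * (K - i)`!)%:R)^-1 * (2 * e) ^+ K)).
  apply: ler_pM => //; rewrite ?invr_ge0//.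
    by rewrite mulr_ge0// exprn_ge0// ltW.
  by rewrite lef_pV2 ?posrE// (lt_le_trans f0).
have K1 : K`!%:R <= 2 ^+ K * (i`! * (K - i)`!)%:R :> R.
  rewrite -(bin_fact iK) natrM ler_wpM2r ?ler0n// -natrX ler_nat.
  by rewrite -[in X in (_ <= X)%N](addn1 1) expnDn (bigD1 (Ordinal (iK : (i < K.+1)%N)))//= !exp1n !muln1 leq_addr.
rewrite ler_pdivrMl// mulrA.
have Kf : 0 < K`!%:R :> R by rewrite ltr0n fact_gt0.
rewrite ler_pdivlMr//.
rewrite expr_div_n !exprMn.
have -> : d ^+ K * (i`! * (K - i)`!)%:R * (4 ^+ K * e ^+ K / d ^+ K) =
  (2 ^+ K * e ^+ K) * (2 ^+ K * (i`! * (K - i)`!)%:R).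
  have -> : 4 = 2 * 2 :> R by rewrite -natrM.
  by rewrite exprMn; field; rewrite gt_eqF ?exprn_gt0.
by rewrite ler_wpM2l// mulr_ge0 ?exprn_ge0// ltW.
Qed.

End Interpolation.

(** * Laguerre coefficients from values of the Laplace transform *)

Section Observability.
Context {R : realType}.
Implicit Types (a s h e w : R) (f : R -> R) (n m i j K N : nat).

Lemma sqr_le_norm (x y : R) : 0 <= y -> x ^+ 2 <= y ^+ 2 -> `|x| <= y.
Proof.
by move=> y0; rewrite -(real_normK (num_real x)) => h; rewrite -(ler_pXn2r (n := 2)) ?nnegrE.
Qed.

Lemma expn_fact_le K : (K.+1%:R) ^+ K / K`!%:R <= expR K.+1%:R :> R.
Proof.
have h := expR_ge1Dxn K (ler0n R K.+1).
rewrite [leLHS](_ : _ = K.+1%:R ^+ K.+1 / K.+1`!%:R); first by lra.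
by rewrite exprS factS natrM; field; rewrite nat1r pnatr_eq0 /= pnatr_eq0 -lt0n fact_gt0.
Qed.

(** The nodes s j lie in every other interval of length h = a e / (K + 1) to the right of a, so
    that distinct nodes i, j are at distance at least |i - j| h. In the variable
    z = (s - a) / (s + a) they lie in [0, e] with separation h / (8 a), and
    interpolation_coef_bound applies to the power series of ip_exp_approx cut at degree K. The
    rate 32^K e^(K+1) does not depend on e. *)
Lemma laguerre_coef_node_bound a e f K (s : nat -> R) w n : 0 < a -> 0 < e -> e <= 1 -> L2 f ->
  (forall j, (j <= K)%N ->
     a + (2 * j)%:R * (a * e / K.+1%:R) <= s j <= a + (2 * j).+1%:R * (a * e / K.+1%:R)) ->
  (forall j, (j <= K)%N -> `|ip (exp_poly (s j) 1) f| <= w) -> (n <= K)%N ->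
  `|laguerre_coef a f n| * e ^+ n <=
  K.+1%:R * (2 * (w + Num.sqrt (ip f f) * e ^+ K.+1 / Num.sqrt (2 * a))) *
  (32 ^+ K * expR K.+1%:R).
Proof.
move=> a0 e0 e1 hf hs hw nK.
set h := a * e / K.+1%:R in hs.
have K0 : 0 < K.+1%:R :> R by rewrite ltr0n.
have h0 : 0 < h by rewrite /h divr_gt0 ?mulr_gt0.
have hK : h * K.+1%:R = a * e by rewrite /h mulfVK// gt_eqF.
have sj j : (j <= K)%N -> a <= s j <= a + 2 * a * e.
  move=> jK; have /andP[h1 h2] := hs j jK; apply/andP; split.
    by apply: le_trans h1; rewrite lerDl mulr_ge0// ltW.
  have -> : 2 * a * e = (2 * K.+1)%:R * h by rewrite -mulrA -hK natrM; ring.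
  apply: (le_trans h2); rewrite lerD2l ler_wpM2r ?(ltW h0)// ler_nat.
  by rewrite mulnS; lia.
pose z j := (s j - a) / (s j + a).
have sa j : (j <= K)%N -> 0 < s j + a by move=> /sj /andP[? _]; lra.
have sa4 j : (j <= K)%N -> s j + a <= 4 * a by move=> /sj /andP[? ?]; nra.
have zj j : (j <= K)%N -> 0 <= z j <= e.
  move=> jK; have /andP[h1 h2] := sj j jK; have h3 := sa j jK; apply/andP; split.
    by rewrite /z divr_ge0 ?subr_ge0// ltW.
  by rewrite /z ler_pdivrMr//; nra.
have dz i j : (i <= K)%N -> (j <= K)%N ->
    ((i - j) + (j - i))%N%:R * (h / (8 * a)) <= `|z i - z j|.
  move=> iK jK.
  have hsub : ((i - j) + (j - i))%N%:R * h <= `|s i - s j|.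
    wlog ij : i j iK jK / (i <= j)%N.
      move=> H; case/orP: (leq_total i j) => ij; first exact: H.
      by rewrite addnC distrC; apply: H.
    have /andP[i1 i2] := hs i iK; have /andP[j1 j2] := hs j jK.
    move: ij; rewrite leq_eqVlt => /orP[/eqP ->|ij].
      by rewrite subnn addn0 mul0r.
    have -> : ((i - j) + (j - i) = j - i)%N by lia.
    rewrite natrB; last exact: ltnW.
    have ij1 : i%:R + 1 <= j%:R :> R by rewrite natr1 ler_nat.
    rewrite distrC; apply: le_trans (ler_norm _).
    have i3 : (2 * i).+1%:R = 2 * i%:R + 1 :> R by rewrite -natr1 natrM.
    have j3 : (2 * j)%:R = 2 * j%:R :> R by rewrite natrM.
    rewrite i3 in i2; rewrite j3 in j1.
    by nra.
  have -> : z i - z j = 2 * a * (s i - s j) / ((s i + a) * (s j + a)).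
    by rewrite /z; field; rewrite !gt_eqF ?sa.
  have p0 : 0 < (s i + a) * (s j + a) by rewrite mulr_gt0 ?sa.
  rewrite normrM normfV (gtr0_norm p0) normrM gtr0_norm ?mulr_gt0// ler_pdivlMr//.
  have p1 : (s i + a) * (s j + a) <= (4 * a) * (4 * a) by rewrite ler_pM ?sa4// ltW ?sa.
  move: (((i - j) + (j - i))%N%:R) (ler0n R ((i - j) + (j - i))) hsub => k k0 hsub.
  have q0 : 0 <= k * (h / (8 * a)) by rewrite mulr_ge0// divr_ge0 ?mulr_ge0// ltW.
  apply: le_trans (ler_wpM2l q0 p1) _.
  rewrite [leLHS](_ : _ = 2 * a * (k * h)); last by field; rewrite gt_eqF.
  by rewrite ler_wpM2l// mulr_ge0// ltW.
set A := Num.sqrt (ip f f).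
have A0 : 0 <= A by rewrite sqrtr_ge0.
have A2 : A ^+ 2 = ip f f by rewrite sqr_sqrtr// ip_ge0.
set r := Num.sqrt (2 * a).
have r0 : 0 < r by rewrite sqrtr_gt0 mulr_gt0.
have r2 : r ^+ 2 = 2 * a by rewrite sqr_sqrtr// mulr_ge0// ltW.
pose P : {poly R} := \poly_(m < K.+1) laguerre_coef a f m.
have hP j : (j <= K)%N -> `|P.[z j]| <= 2 * (w + A * e ^+ K.+1 / r).
  move=> jK; have /andP[s1 s2] := sj j jK; have s0 : 0 < s j by lra.
  have /andP[z0 z1] := zj j jK.
  have ap := ip_exp_approx K.+1 a0 s0 hf; rewrite -/(z j) in ap.
  have PE : P.[z j] = \sum_(m < K.+1) laguerre_coef a f m * z j ^+ m by rewrite /P horner_poly.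
  rewrite -PE in ap.
  have b1 : `|ip (exp_poly (s j) 1) f - 2 * a / (s j + a) * P.[z j]| <= A * e ^+ K.+1 / r.
    apply: sqr_le_norm; first by rewrite divr_ge0 ?mulr_ge0 ?exprn_ge0 ?(ltW r0) ?(ltW e0).
    apply: (le_trans ap).
    have -> : (A * e ^+ K.+1 / r) ^+ 2 = A ^+ 2 * ((e ^+ K.+1) ^+ 2 / r ^+ 2).
      by field; rewrite gt_eqF.
    rewrite A2 r2 ler_wpM2l ?ip_ge0//.
    rewrite -exprM [(K.+1 * 2)%N]mulnC; apply: ler_pM.
    - exact: exprn_ge0.
    - by rewrite invr_ge0 mulr_ge0// ltW.
    - by rewrite lerXn2r ?nnegrE// ltW.
    - by rewrite lef_pV2 ?posrE ?mulr_gt0// ler_pM2l.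
  have b2 : `|2 * a / (s j + a) * P.[z j]| <= w + A * e ^+ K.+1 / r.
    have -> : 2 * a / (s j + a) * P.[z j] = ip (exp_poly (s j) 1) f -
      (ip (exp_poly (s j) 1) f - 2 * a / (s j + a) * P.[z j]) by ring.
    by apply: le_trans (ler_normB _ _) _; rewrite lerD// hw.
  have b3 : `|P.[z j]| <= 2 * `|2 * a / (s j + a) * P.[z j]|.
    rewrite normrM mulrA ler_peMl// gtr0_norm ?divr_gt0 ?mulr_gt0 ?sa//.
    by rewrite mulrA ler_pdivlMr ?sa// mul1r; have := sa4 j jK; lra.
  by apply: le_trans b3 _; rewrite ler_wpM2l.
have d0 : 0 < h / (8 * a) by rewrite divr_gt0 ?mulr_gt0.
have sP : (size P <= K.+1)%N by exact: size_poly.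
have := interpolation_coef_bound n e0 d0 sP zj dz hP.
rewrite /P coef_poly ltnS nK => H; apply: (le_trans H).
have -> : 4 * e / (h / (8 * a)) = 32 * K.+1%:R.
  by rewrite /h; field; rewrite !gt_eqF//= ?ltr0n.
rewrite exprMn -!mulrA ler_wpM2l ?ler0n//.
set B := w + _.
have B0 : 0 <= B.
  rewrite addr_ge0//; first by apply: le_trans (hw 0%N (leq0n K)).
  by rewrite !mulr_ge0 ?invr_ge0 ?exprn_ge0 ?(ltW r0) ?(ltW e0).
rewrite ler_wpM2l// ler_wpM2l// ler_wpM2l ?exprn_ge0//.
exact: expn_fact_le.
Qed.

End Observability.

(** * The exponential lower bound *)

Section LowerBound.
Context {R : realType}.
Implicit Types (a b s t r : R) (f : R -> R) (n m i j K N : nat).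

(** n + 1 <= e^n for each of the polynomial factors. *)
Lemma polynomial_growth N : N%:R * (4 * N).+1%:R ^+ 2 * (32 ^+ (4 * N) * expR (4 * N).+1%:R) <=
  expR 1 * (expR 13 * 32 ^+ 4) ^+ N :> R.
Proof.
have e1 n : n.+1%:R <= expR n%:R :> R by rewrite -nat1r expR_ge1Dx.
have e2 : N%:R <= expR N%:R :> R by apply: le_trans (e1 N); rewrite ler_nat.
have -> : expR 1 * (expR 13 * 32 ^+ 4) ^+ N =
    expR N%:R * expR (4 * N)%:R ^+ 2 * (32 ^+ (4 * N) * expR (4 * N).+1%:R) :> R.
  rewrite exprMn -exprM [32 ^+ _ * expR _]mulrC !mulrA; congr (_ * _).
  rewrite -!expRM_natl -!expRD; congr expR.
  by rewrite -[(4 * N).+1%:R]natr1 natrM; ring.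
rewrite ler_wpM2r ?mulr_ge0 ?exprn_ge0 ?expR_ge0// ler_pM ?ler0n ?exprn_ge0//.
by rewrite lerXn2r ?nnegrE ?expR_ge0.
Qed.

(** Apply laguerre_coef_node_bound with K = 4 N to the coefficients of index n < N only. Recovering
    them costs a factor rho^N t^(-N), while the truncation of the power series contributes
    t^(4 N) times the norm of f: the resulting rho^N t^(3 N) is absorbed once t is small, rho
    being independent of t. *)
Lemma laplace_lower_bound a b : 0 < a -> a < b -> exists c q : R, [/\ 0 < c, 0 < q, q < 1 &
  forall f N r, L2 f -> (0 < N)%N -> 0 <= r ->
    ip f f <= 2 * (2 * a * \sum_(n < N) laguerre_coef a f n ^+ 2) ->
    (forall s1 s2, a <= s1 -> s1 < s2 -> s2 <= b ->
      exists2 s, s1 <= s <= s2 & ip (exp_poly s 1) f ^+ 2 * (s2 - s1) <= r ^+ 2) ->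
    c * q ^+ N * Num.sqrt (ip f f) <= r].
Proof.
move=> a0 ab.
pose E := expR 1 : R; pose rho := expR 13 * 32 ^+ 4 : R.
have E1 : 1 <= E by rewrite /E -[leLHS]expR0 ler_expR.
have E0 : 0 < E by rewrite expR_gt0.
have rho1 : 1 <= rho.
  apply: mulr_ege1; first by rewrite -[leLHS]expR0 ler_expR.
  by apply: exprn_ege1; rewrite ler1n.
have rho0 : 0 < rho by apply: lt_le_trans rho1.
(* t <= (b - a) / (2 a) keeps the nodes in [a, b], and t <= 1 / (8 E rho) makes the truncation
   error absorbable *)
pose t := Num.min (2^-1) (Num.min ((b - a) / (2 * a)) (8 * E * rho)^-1).
have ba0 : 0 < (b - a) / (2 * a) by rewrite divr_gt0 ?mulr_gt0 ?subr_gt0.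
have t0 : 0 < t.
  by rewrite /t !lt_min ba0 (invr_gt0 2) ltr0n /= invr_gt0 mulr_gt0 ?(mulr_gt0 _ E0) ?ltr0n.
have t12 : t <= 2^-1 by rewrite /t ge_min lexx.
have t1 : t <= 1 by lra.
have tb : a + 2 * a * t <= b.
  have : t <= (b - a) / (2 * a) by rewrite /t !ge_min lexx orbT.
  by rewrite ler_pdivlMr ?mulr_gt0// => h; lra.
have tr : t * (8 * E * rho) <= 1.
  rewrite -ler_pdivlMr ?mulr_gt0// mul1r.
  by rewrite /t !ge_min lexx !orbT.
exists (Num.sqrt t / (8 * E)), (t / rho); split.
- by rewrite divr_gt0 ?sqrtr_gt0 ?mulr_gt0.
- by rewrite divr_gt0.
- by rewrite ltr_pdivrMr// mul1r; lra.
move=> f N r hf N0 r0 hA hv.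
set A := Num.sqrt (ip f f).
have A0 : 0 <= A by rewrite sqrtr_ge0.
have A2 : A ^+ 2 = ip f f by rewrite sqr_sqrtr// ip_ge0.
have [K KE] : exists K, K = (4 * N)%N by exists (4 * N)%N.
pose h := a * t / K.+1%:R.
have K0 : 0 < K.+1%:R :> R by rewrite ltr0n.
have K1 : 1 <= K.+1%:R :> R by rewrite ler1n.
have h0 : 0 < h by rewrite /h divr_gt0 ?mulr_gt0.
have hK : h * K.+1%:R = a * t by rewrite /h mulfVK// gt_eqF.
have at0 : 0 < a * t by rewrite mulr_gt0.
pose sat := Num.sqrt (a * t).
have sat0 : 0 < sat by rewrite sqrtr_gt0.
have sat2 : sat ^+ 2 = a * t by rewrite sqr_sqrtr// ltW.
pose w := r * K.+1%:R / sat.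
have node j : exists s, (j <= K)%N ->
    a + (2 * j)%:R * h <= s <= a + (2 * j).+1%:R * h /\ `|ip (exp_poly s 1) f| <= w.
  have [jK|jK] := leqP j K; last by exists 0.
  have [|||s hs hF] := hv (a + (2 * j)%:R * h) (a + (2 * j).+1%:R * h).
  - by rewrite lerDl mulr_ge0// ltW.
  - by rewrite ltrD2l ltr_pM2r// ltr_nat.
  - apply: le_trans tb; rewrite lerD2l.
    have -> : 2 * a * t = (2 * K.+1)%:R * h by rewrite -mulrA -hK natrM; ring.
    have jk : ((2 * j).+1 <= 2 * K.+1)%N by clear -jK; lia.
    by rewrite ler_wpM2r ?(ltW h0)// ler_nat.
  exists s => _; split=> //; apply: sqr_le_norm.
    by rewrite /w !mulr_ge0 ?invr_ge0// ltW.
  have e1 : a + (2 * j).+1%:R * h - (a + (2 * j)%:R * h) = h by rewrite -natr1; ring.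
  rewrite e1 -ler_pdivlMr// in hF; apply: le_trans hF _.
  rewrite /w; have -> : (r * K.+1%:R / sat) ^+ 2 = r ^+ 2 * (K.+1%:R ^+ 2 / sat ^+ 2).
    by field; rewrite gt_eqF.
  rewrite ler_wpM2l ?sqr_ge0// sat2 /h invf_div ler_wpM2r ?invr_ge0 ?(ltW at0)//.
  by rewrite expr2 ler_peMr// ltW.
pose s j := projT1 (cid (node j)).
have hs j : (j <= K)%N -> a + (2 * j)%:R * (a * t / K.+1%:R) <= s j <= a + (2 * j).+1%:R * (a * t / K.+1%:R).
  by move=> jK; have [] := projT2 (cid (node j)) jK.
have hw j : (j <= K)%N -> `|ip (exp_poly (s j) 1) f| <= w.
  by move=> jK; have [] := projT2 (cid (node j)) jK.
have NK : (N <= K)%N by clear -KE; lia.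
pose r2a := Num.sqrt (2 * a).
have r2a0 : 0 < r2a by rewrite sqrtr_gt0 mulr_gt0.
pose M := K.+1%:R * (2 * (w + A * t ^+ K.+1 / r2a)) * (32 ^+ K * expR K.+1%:R).
have w0 : 0 <= w by rewrite /w !mulr_ge0 ?invr_ge0// ltW.
have wA0 : 0 <= w + A * t ^+ K.+1 / r2a.
  by rewrite addr_ge0// !mulr_ge0 ?invr_ge0 ?exprn_ge0 ?(ltW r2a0) ?(ltW t0).
have M0 : 0 <= M.
  by rewrite /M !mulr_ge0 ?exprn_ge0 ?expR_ge0.
have cn n : (n < N)%N -> `|laguerre_coef a f n| * t ^+ N <= M.
  move=> nN; apply: le_trans (laguerre_coef_node_bound a0 t0 t1 hf hs hw (leq_trans (ltnW nN) NK)).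
  by rewrite ler_wpM2l// ler_wiXn2l ?(ltW t0)// ltnW.
have tN0 : 0 < t ^+ N by rewrite exprn_gt0.
pose sa := Num.sqrt a.
have sa0 : 0 < sa by rewrite sqrtr_gt0.
have sa2 : sa ^+ 2 = a by rewrite sqr_sqrtr// ltW.
have NR : 1 <= N%:R :> R by rewrite ler1n.
have main1 : A * t ^+ N <= 2 * sa * N%:R * M.
  rewrite -(ler_pXn2r (n := 2)) ?nnegrE ?mulr_ge0 ?(ltW tN0) ?(ltW sa0)//.
  rewrite exprMn A2; apply: (@le_trans _ _ (2 * (2 * a * (N%:R * M ^+ 2)))).
    apply: le_trans (ler_wpM2r (sqr_ge0 _) hA) _.
    rewrite -!mulrA !ler_wpM2l ?(ltW a0)// mulr_suml.
    rewrite -[N in N%:R * _](card_ord N) mulr_natl -sumr_const.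
    apply: ler_sum => n _; rewrite -exprMn -real_normK ?num_real// lerXn2r ?nnegrE//.
    by rewrite normrM (gtr0_norm tN0) cn.
  have -> : (2 * sa * N%:R * M) ^+ 2 = 4 * sa ^+ 2 * (N%:R ^+ 2 * M ^+ 2) by ring.
  rewrite sa2 [leLHS](_ : _ = 4 * a * (N%:R * M ^+ 2)); last by ring.
  rewrite ler_wpM2l ?mulr_ge0 ?(ltW a0)// ler_wpM2r ?sqr_ge0//.
  by rewrite expr2 ler_peMr.
pose T := N%:R * K.+1%:R ^+ 2 * (32 ^+ K * expR K.+1%:R) : R.
have T0 : 0 <= T by rewrite /T !mulr_ge0 ?exprn_ge0 ?expR_ge0.
have TE : T <= E * rho ^+ N by rewrite /T KE; exact: polynomial_growth.
pose st := Num.sqrt t.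
have st0 : 0 < st by rewrite sqrtr_gt0.
have satE : sat = sa * st by rewrite /sat sqrtrM// ltW.
have r2aE : sa <= r2a.
  by rewrite /r2a /sa ler_wsqrtr//; lra.
have main2 : 2 * sa * N%:R * M <= T * (4 * r / st + 4 * (A * t ^+ K)).
  have -> : 2 * sa * N%:R * M = (N%:R * K.+1%:R * (32 ^+ K * expR K.+1%:R)) *
     (4 * r * K.+1%:R / st + 4 * (A * t ^+ K.+1) * (sa / r2a)).
    by rewrite /M /w satE; field; rewrite !gt_eqF.
  have -> : T = (N%:R * K.+1%:R * (32 ^+ K * expR K.+1%:R)) * K.+1%:R by rewrite /T; ring.
  rewrite -[leRHS]mulrA; apply: ler_wpM2l; first by rewrite !mulr_ge0 ?exprn_ge0 ?expR_ge0.
  rewrite mulrDr lerD//; first by rewrite le_eqVlt; apply/orP; left; apply/eqP; ring.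
  have tK : t ^+ K.+1 <= t ^+ K by rewrite ler_wiXn2l// ltW.
  have tk0 : 0 <= t ^+ K.+1 by rewrite exprn_ge0// ltW.
  have q1 : sa / r2a <= 1 by rewrite ler_pdivrMr// mul1r.
  have q0 : 0 <= sa / r2a by rewrite divr_ge0// ltW.
  apply: (@le_trans _ _ (4 * (A * t ^+ K.+1))).
    by rewrite ler_piMr// !mulr_ge0.
  apply: (@le_trans _ _ (4 * (A * t ^+ K))); first by rewrite ler_wpM2l// ler_wpM2l.
  by rewrite ler_peMl// !mulr_ge0// (le_trans tk0).
have main3 : A * t ^+ N <= E * rho ^+ N * (4 * r / st + 4 * (A * t ^+ K)).
  apply: le_trans main1 (le_trans main2 _); rewrite ler_wpM2r// addr_ge0 ?divr_ge0 ?mulr_ge0 ?exprn_ge0 ?(ltW st0)//.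
  exact: ltW.
have small : E * rho ^+ N * (4 * (A * t ^+ K)) <= 2^-1 * (A * t ^+ N).
  have -> : t ^+ K = t ^+ N * (t ^+ 3) ^+ N by rewrite -exprM -exprD KE; congr (_ ^+ _); clear; lia.
  have p1 : (rho * t ^+ 3) ^+ N <= rho * t ^+ 3.
    rewrite -[leRHS]expr1; apply: ler_wiXn2l => //.
      by rewrite mulr_ge0 ?exprn_ge0// ltW.
    have : t ^+ 3 <= t by rewrite -[leRHS]expr1; apply: ler_wiXn2l; rewrite ?(ltW t0).
    move=> t3; apply: (@le_trans _ _ (rho * t)); first by rewrite ler_wpM2l// ltW.
    apply: le_trans tr; rewrite [leRHS](_ : _ = (rho * t) * (8 * E)); last by ring.
    by rewrite ler_peMr ?mulr_ge0 ?(ltW t0) ?(ltW rho0)//; lra.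
  have p2 : E * (rho * t ^+ 3) <= 8^-1.
    have t3 : t ^+ 3 <= t by rewrite -[leRHS]expr1; apply: ler_wiXn2l; rewrite ?(ltW t0).
    apply: (@le_trans _ _ (E * (rho * t))); first by rewrite !ler_wpM2l// ltW.
    have -> : E * (rho * t) = t * (8 * E * rho) / 8 by field.
    by lra.
  have -> : E * rho ^+ N * (4 * (A * (t ^+ N * (t ^+ 3) ^+ N))) =
     (4 * (E * (rho * t ^+ 3) ^+ N)) * (A * t ^+ N).
    by rewrite [(rho * _) ^+ N]exprMn; move: ((t ^+ 3) ^+ N) => y; ring.
  rewrite ler_wpM2r ?mulr_ge0 ?(ltW tN0)//.
  have := ler_wpM2l (ltW E0) p1; lra.
have main4 : A * t ^+ N <= 8 * E * rho ^+ N * r / st.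
  rewrite mulrDr in main3.
  have -> : 8 * E * rho ^+ N * r / st = 2 * (E * rho ^+ N * (4 * r / st)) by ring.
  lra.
rewrite -/st expr_div_n.
have rN0 : 0 < rho ^+ N by rewrite exprn_gt0.
have -> : st / (8 * E) * (t ^+ N / rho ^+ N) * A = (A * t ^+ N) * (st / (8 * E * rho ^+ N)).
  by field; rewrite !gt_eqF.
rewrite ler_pdivlMr// in main4.
by rewrite mulrA ler_pdivrMr ?mulr_gt0// mulrC -mulrA [_ * r]mulrC in main4 *; rewrite mulrC; lra.
Qed.

End LowerBound.

(** * Norms, integrals and Laplace transforms on the closed half-line *)

Section Translation.
Context {R : realType}.
Implicit Types (a b s t x : R) (f g : R -> R).
Local Notation mu := (@lebesgue_measure R).
Local Notation D := (`]0, +oo[%classic : set R).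
Local Notation D0 := (`[0%R, +oo[%classic : set R).

Lemma L2norm_sqr (E : set R) f : (L2norm E f `^ 2 = \int[mu]_(x in E) (f x ^+ 2)%:E)%E.
Proof.
rewrite /L2norm poweR_Lnorm// [RHS]integral_mkcond; apply: eq_integral => x _.
rewrite /= !patchE; case: ifPn => _.
  by rewrite powR_mulrn// real_normK// num_real.
by rewrite powR_mulrn// real_normK ?num_real// expr0n.
Qed.

Lemma L2norm_ge0 (E : set R) f : (0 <= L2norm E f)%E.
Proof. exact: Lnorm_ge0. Qed.

Lemma measurable_inL2 f : inL2 D0 f -> measurable_fun D0 f.
Proof.
move=> hf; have [mf _] := andP hf; move: mf; rewrite inE /= => mf.
by apply/(measurable_restrictT _ _).
Qed.

Lemma inL2_L2 f : inL2 D0 f -> L2 f.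
Proof.
move=> hf.
have mf := measurable_inL2 hf.
have := Lfun2_integrable_sqr hf => h; split.
  by apply: measurable_funS mf => //; apply: subset_itvr; rewrite bnd_simp.
have h2 : mu.-integrable D (EFin \o (fun x => ((f \_ D0) x) ^+ 2)).
  by apply: integrableS h.
apply: eq_integrable h2 => // x; rewrite inE /= in_itv /= andbT => x0.
by rewrite patchE ifT// inE /= in_itv /= andbT ltW.
Qed.

Lemma finite_inL2 f : measurable_fun D0 f -> (L2norm D0 f < +oo)%E ->
  inL2 D0 f.
Proof.
move=> mf ff; rewrite /inL2 inE; apply/andP; split; rewrite inE//=.
have mD0 : measurable D0 by exact: measurable_itv.
exact: ((measurable_restrictT f mD0).1 mf).
Qed.

Lemma L2normE f : inL2 D0 f -> L2norm D0 f = (Num.sqrt (ip f f))%:E.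
Proof.
move=> hf; have hL := inL2_L2 hf; have [mf i_f] := hL.
have e : (L2norm D0 f `^ 2 = (ip f f)%:E)%E.
  rewrite L2norm_sqr -integral_itv_obnd_cbnd; last first.
    by apply/measurable_EFinP; apply: measurable_funX.
  rewrite /ip /Rintegral fineK; last first.
    by apply: integrable_fin_num => //; exact: integrable_mul.
  by apply: eq_integral => x _; rewrite expr2.
have N0 := L2norm_ge0 D0 f.
have := f_equal (fun y => y `^ 2^-1)%E e.
rewrite -poweRrM mulfV// poweRe1// => ->.
by rewrite poweR_EFin powR12_sqrt// ip_ge0.
Qed.

(** A function of norm zero vanishes almost everywhere. *)
Lemma ip_gt0 f : inL2 D0 f -> ~ ae_eq mu `[0, +oo[%classic f (cst 0) -> 0 < ip f f.
Proof.
move=> hf hne; rewrite lt0r ip_ge0 andbT; apply/eqP => f0; apply: hne.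
have N0 : L2norm D0 f = 0%E by rewrite L2normE// f0 sqrtr0.
have mf : measurable_fun [set: R] (EFin \o (f \_ D0)).
  apply/measurable_EFinP; have mD0 : measurable D0 by exact: measurable_itv.
  exact: ((measurable_restrictT f mD0).1 (measurable_inL2 hf)).
have p0 : (0%R < 2%:E :> \bar R)%E by rewrite lte_fin.
have : (EFin \o (f \_ D0)) = \0%E %[ae mu].
  by apply: (Lnorm_eq0_eq0 _ p0 N0); exact: mf.
move=> [A [mA A0 sA]]; exists A; split => // x /= hx; apply: sA => /= h; apply: hx => xD.
by have := h I; rewrite patchE ifT ?inE// => -[].
Qed.

Lemma laplace_adjE f s : 0 < s -> L2 f -> laplace_adj f s = ip (exp_poly s 1) f.
Proof.
move=> s0 hf; rewrite /laplace_adj -Rintegral_itv_obnd_cbnd; last first.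
  have := integrable_mul (L2_exp_poly 1 s0) hf; apply: eq_integrable => // x _.
  by rewrite /= /exp_poly hornerC mul1r.
by apply: eq_Rintegral => x _; rewrite /exp_poly hornerC mul1r.
Qed.

(** By ip_exp_approx it is a pointwise limit of rational functions. *)
Lemma measurable_laplace a b f : 0 < a -> L2 f -> measurable_fun `[a, b] (laplace_adj f).
Proof.
move=> a0 hf.
pose P K : {poly R} := \poly_(n < K) laguerre_coef a f n.
pose G K s := 2 * a / (s + a) * (P K).[(s - a) / (s + a)].
have mG K : measurable_fun D (G K).
  apply: open_continuous_measurable_fun; first exact: interval_open.
  move=> s; rewrite inE /= in_itv /= andbT => s0.
  have c1 : (x + a)^-1 @[x --> s] --> (s + a)^-1.
    apply: cvgV; first by rewrite gt_eqF// addr_gt0.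
    by apply: (@cvgD _ R^o); [exact: cvg_id|exact: cvg_cst].
  have c2 : (x - a) / (x + a) @[x --> s] --> (s - a) / (s + a).
    by apply: cvgM c1; apply: (@cvgB _ R^o); [exact: cvg_id|exact: cvg_cst].
  rewrite /continuous_at /G; apply: cvgM; first by apply: cvgM c1; exact: cvg_cst.
  by apply: (cvg_comp _ _ c2); exact: continuous_horner.
have mF : measurable_fun D (laplace_adj f).
  apply: (measurable_fun_cvg mG) => s; rewrite /= in_itv /= andbT => s0.
  rewrite laplace_adjE//.
  have sa : 0 < s + a by rewrite addr_gt0.
  pose z := ((s - a) / (s + a)) ^+ 2.
  have z1 : `|z| < 1.
    rewrite ger0_norm ?sqr_ge0// /z expr_div_n ltr_pdivrMr ?exprn_gt0// mul1r.
    by rewrite -subr_gt0 subr_sqr; nra.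
  apply/cvgrPdist_lt => e e0.
  have e2 : 0 < e ^+ 2 / (ip f f / (2 * s) + 1).
    by rewrite divr_gt0 ?exprn_gt0// ltr_wpDl// divr_ge0 ?ip_ge0// mulr_ge0// ltW.
  have /cvgrPdist_lt/(_ _ e2) [K0 _ hK] := cvg_expr z1.
  exists K0 => // K /hK /=; have zK0 : 0 <= z ^+ K by apply: exprn_ge0; exact: sqr_ge0.
  rewrite sub0r normrN (ger0_norm zK0) ltr_pdivlMr ?ltr_wpDl ?divr_ge0 ?ip_ge0 ?mulr_ge0 ?(ltW s0)//.
  move=> zK; rewrite -(ltr_pXn2r (n := 2)) ?nnegrE ?(ltW e0)// real_normK ?num_real//.
  have := ip_exp_approx K a0 s0 hf; rewrite exprM -/z.
  rewrite (_ : \sum_(n < K) _ = (P K).[(s - a) / (s + a)]); last by rewrite horner_poly.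
  move=> h; apply: (le_lt_trans h); apply: le_lt_trans zK.
  have : 0 <= z ^+ K by [].
  by move: (z ^+ K) => y y0; rewrite mulrDr mulr1 mulrCA lerDl.
apply: measurable_funS mF => // x /=; rewrite !in_itv /= andbT => /andP[ax _].
exact: lt_le_trans ax.
Qed.

(** F^2 cannot exceed its mean value everywhere on [s1, s2]. *)
Lemma mean_value_node a b (F : R -> R) r s1 s2 : 0 <= r -> measurable_fun `[a, b] F ->
  (L2norm `[a, b] F < r%:E)%E -> a <= s1 -> s1 < s2 -> s2 <= b ->
  exists2 s, s1 <= s <= s2 & F s ^+ 2 * (s2 - s1) <= r ^+ 2.
Proof.
move=> r0 mF hF as1 s12 s2b; apply: contrapT => hn.
have big s : s1 <= s <= s2 -> r ^+ 2 / (s2 - s1) <= F s ^+ 2.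
  move=> hs; rewrite ler_pdivrMr ?subr_gt0// leNgt; apply/negP => h.
  by apply: hn; exists s => //; exact: ltW.
have sub : `[s1, s2] `<=` `[a, b].
  by apply: subset_itvScc; rewrite bnd_simp.
have mF2 : measurable_fun `[a, b] (fun x => (F x ^+ 2)%:E).
  by apply/measurable_EFinP; apply: measurable_funX.
have h1 : ((r ^+ 2)%:E <= \int[mu]_(x in `[a, b]) (F x ^+ 2)%:E)%E.
  apply: (@le_trans _ _ (\int[mu]_(x in `[s1, s2]) (r ^+ 2 / (s2 - s1))%:E)%E).
    rewrite integral_cst//= lebesgue_measure_itv /= lte_fin s12 -EFinD -EFinM.
    by rewrite lee_fin mulfVK// gt_eqF// subr_gt0.
  apply: (@le_trans _ _ (\int[mu]_(x in `[s1, s2]) (F x ^+ 2)%:E)%E).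
    apply: ge0_le_integral => //.
    - by move=> x _; rewrite lee_fin divr_ge0 ?sqr_ge0// subr_ge0 ltW.
    - by apply: measurable_funS mF2.
  apply: ge0_subset_integral => //.
  by move=> x _; rewrite lee_fin sqr_ge0.
rewrite -L2norm_sqr in h1.
have h2 : (L2norm `[a, b] F `^ 2 < (r ^+ 2)%:E)%E.
  move: hF (L2norm_ge0 `[a, b] F); case: (L2norm _ _) => [y| |] //.
  rewrite lte_fin lee_fin => yr y0; rewrite poweR_EFin lte_fin powR_mulrn//.
  by rewrite ltrXn2r// ?nnegrE.
by have := le_lt_trans h1 h2; rewrite ltxx.
Qed.

End Translation.

(** * Concentration on the first Laguerre coefficients *)

Section MainEstimate.
Context {R : realType}.
Implicit Types (a b : R) (f : R -> R) (n K N : nat).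
Local Notation D0 := (`[0%R, +oo[%classic : set R).

(** By laguerre_coef_decay the coefficients of index at least N carry at most a multiple of
    (M / N)^2 of the squared norm, and by laguerre_complete all coefficients carry the whole of
    it. *)
Lemma laguerre_concentration a : 0 < a -> exists2 k : R, 0 < k & forall (f fx fxx : R -> R) (M : R),
  inH2 f fx fxx -> L2 (fun x => x * f x) -> L2 (fun x => x * fx x) -> L2 (fun x => x * fxx x) ->
  0 < ip f f -> 1 <= M ->
  Num.sqrt (ip (fun x => x * f x) (fun x => x * f x)) +
  Num.sqrt (ip (fun x => x * fxx x) (fun x => x * fxx x)) <= M * Num.sqrt (ip f f) ->
  exists N, [/\ (0 < N)%N, N%:R <= k * M &
    ip f f <= 2 * (2 * a * \sum_(n < N) laguerre_coef a f n ^+ 2)].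
Proof.
move=> a0; pose C : R := 3 * (a ^+ 4 + 5).
have C1 : 1 <= C by rewrite /C; have := exprn_ge0 4 (ltW a0); lra.
have C0 : 0 < C by lra.
(* C <= (1 + C)^2, so that N >= k M implies C M^2 <= (a N)^2 *)
pose k := (1 + C) / a.
have k0 : 0 < k by rewrite divr_gt0// ltr_wpDl.
exists (k + 1); first by rewrite addr_gt0.
move=> f fx fxx M [/inL2_L2 hf /inL2_L2 hfx /inL2_L2 hfxx w1 w2] h0 h1 h2 f0 M1 hM.
have kM : 0 <= k * M by rewrite mulr_ge0 ?(ltW k0)// (le_trans _ M1).
have /andP[t1 t2] := truncn_itv kM.
pose N := (Num.trunc (k * M)).+1; exists N; split => //.
  by rewrite /N -natr1 mulrDl mul1r lerD.
set X0 := Num.sqrt _ in hM; set X2 := Num.sqrt (ip (fun x => x * fxx x) _) in hM.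
set A := Num.sqrt (ip f f) in hM.
have A2 : A ^+ 2 = ip f f by rewrite sqr_sqrtr// ip_ge0.
have X02 : X0 ^+ 2 = ip (fun x => x * f x) (fun x => x * f x) by rewrite sqr_sqrtr// ip_ge0.
have X22 : X2 ^+ 2 = ip (fun x => x * fxx x) (fun x => x * fxx x) by rewrite sqr_sqrtr// ip_ge0.
have X0p : 0 <= X0 by rewrite sqrtr_ge0.
have X2p : 0 <= X2 by rewrite sqrtr_ge0.
have Ap : 0 <= A by rewrite sqrtr_ge0.
have [K0 hK] := laguerre_complete a0 hf (divr_gt0 f0 (ltr0Sn R 3)).
pose K := (N + K0)%N.
have hKd : defect a K f <= ip f f / 4 by apply: hK; rewrite /K leq_addl.
have dec := laguerre_coef_decay K a0 w1 w2 hf hfx hfxx h0 h1 h2.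
rewrite -X02 -X22 in dec.
have bnd : 3 * (a ^+ 4 * X0 ^+ 2 + 5 * X2 ^+ 2) <= C * (M * A) ^+ 2.
  have s0 : X0 ^+ 2 <= (M * A) ^+ 2 by rewrite lerXn2r ?nnegrE ?mulr_ge0//; lra.
  have s2 : X2 ^+ 2 <= (M * A) ^+ 2 by rewrite lerXn2r ?nnegrE ?mulr_ge0//; lra.
  have a4 : 0 <= a ^+ 4 by rewrite exprn_ge0// ltW.
  by have := ler_wpM2l a4 s0; rewrite /C; lra.
set T := 2 * a * \sum_(n < N) laguerre_coef a f n ^+ 2.
set S := 2 * a * \sum_(n < K0) laguerre_coef a f (N + n)%N ^+ 2.
have split : 2 * a * \sum_(n < K) laguerre_coef a f n ^+ 2 = T + S.
  by rewrite /K big_split_ord /= mulrDr.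
have a20 : 0 < 2 * a by rewrite mulr_gt0.
have N0 : 0 < N%:R :> R by rewrite ltr0n.
have tail : (2 * a * N%:R) ^+ 2 * S <=
    2 * a * \sum_(n < K) (2 * a * (n%:R + 2^-1) * laguerre_coef a f n) ^+ 2.
  rewrite /S mulrCA ler_wpM2l ?(ltW a20)// /K big_split_ord /= mulr_sumr.
  rewrite -[leLHS]add0r lerD//; first by apply: sumr_ge0 => n _; exact: sqr_ge0.
  apply: ler_sum => n _; rewrite [leRHS]exprMn ler_wpM2r ?sqr_ge0// lerXn2r ?nnegrE//.
  - by rewrite mulr_ge0// ltW.
  - by rewrite mulr_ge0 ?(ltW a20)// addr_ge0// ler0n.
  - by rewrite ler_wpM2l ?(ltW a20)// natrD; have := ler0n R n; lra.
have NM : (1 + C) * M <= a * N%:R.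
  have -> : (1 + C) * M = a * (k * M) by rewrite /k; field; rewrite gt_eqF.
  by rewrite ler_pM2l// ltW.
have N2 : C * M ^+ 2 <= (a * N%:R) ^+ 2.
  apply: (@le_trans _ _ (((1 + C) * M) ^+ 2)).
    by rewrite exprMn ler_wpM2r ?sqr_ge0//; nra.
  by rewrite lerXn2r ?nnegrE// mulr_ge0 ?(ltW a0) ?(ltW N0)//; lra.
have Sb : S <= ip f f / 4.
  have aN : 0 < (2 * a * N%:R) ^+ 2 by rewrite exprn_gt0// mulr_gt0.
  rewrite -(ler_pM2l aN); apply: (le_trans tail); apply: (le_trans dec); apply: (le_trans bnd).
  rewrite exprMn mulrA A2; have := ler_wpM2r (ltW f0) N2.
  by rewrite [(2 * a * N%:R) ^+ 2](_ : _ = 4 * (a * N%:R) ^+ 2); [lra|ring].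
rewrite /defect split in hKd; lra.
Qed.

End MainEstimate.

Theorem theorem2 (R : realType) (a b : R) (ha : 0 < a) (hab : a < b) :
  exists c1 c2 : R, [/\ 0 < c1, 0 < c2 &
    forall f fx fxx : R -> R,
      inH2 f fx fxx ->
      ~ ae_eq (@lebesgue_measure R) `[0, +oo[%classic f (cst 0) ->
      (c1%:E
       * expeR (- (c2%:E
           * ((L2norm `[0%R, +oo[ (fun x => (x * fxx x)%R)
               + L2norm `[0%R, +oo[ (fun x => (x * fx x)%R)
               + L2norm `[0%R, +oo[ (fun x => (x * f x)%R)
               + L2norm `[0%R, +oo[ f)
              / L2norm `[0%R, +oo[ f)))
       * L2norm `[0%R, +oo[ f
       <= L2norm `[a, b] (laplace_adj f))%E].
Proof.
have [c [q [c0 q0 q1 lower]]] := laplace_lower_bound ha hab.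
have [k k0 conc] := laguerre_concentration ha.
have lnq : 0 < - (k * ln q) by rewrite -mulrN mulr_gt0// oppr_gt0 ln_lt0// q0 q1.
exists (c / 2), (- (k * ln q)); split => //; first by rewrite divr_gt0.
move=> f fx fxx hH hne; have [hf hfx hfxx w1 w2] := hH.
have f0 := ip_gt0 hf hne.
rewrite (L2normE hf); set A := Num.sqrt (ip f f).
have A0 : 0 < A by rewrite sqrtr_gt0.
set n2 := L2norm _ (fun x => x * fxx x); set n1 := L2norm _ (fun x => x * fx x).
set n0 := L2norm _ (fun x => x * f x).
have n20 : (0 <= n2)%E by exact: L2norm_ge0.
have n10 : (0 <= n1)%E by exact: L2norm_ge0.
have n00 : (0 <= n0)%E by exact: L2norm_ge0.
(* an infinite weighted norm makes the left-hand side 0 *)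
have infinite : (n2 + n1 + n0 + A%:E = +oo ->
  (c / 2)%:E * expeR (- ((- (k * ln q))%:E * ((n2 + n1 + n0 + A%:E) / A%:E))) * A%:E
   <= L2norm `[a, b] (laplace_adj f))%E.
  move=> ->; rewrite inver gt_eqF// gt0_mulye ?lte_fin ?invr_gt0// gt0_muley ?lte_fin//=.
  by rewrite mule0 mul0e L2norm_ge0.
have mx (g : R -> R) : inL2 (`[0%R, +oo[%classic : set R) g ->
    measurable_fun (`[0%R, +oo[%classic : set R) (fun x => x * g x).
  by move=> hg; apply: measurable_funM => //; exact: measurable_inL2.
have nNy (x : \bar R) : (0 <= x)%E -> x != -oo%E by case: x.
have [n2y|n2y] := eqVneq n2 +oo%E.
  by apply: infinite; rewrite n2y addye ?(nNy _ n10)// addye ?(nNy _ n00).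
have [n1y|n1y] := eqVneq n1 +oo%E.
  by apply: infinite; rewrite n1y addey ?(nNy _ n20)// addye ?(nNy _ n00).
have [n0y|n0y] := eqVneq n0 +oo%E.
  by apply: infinite; rewrite n0y addey ?addye// nNy// adde_ge0.
have h2 : inL2 (`[0%R, +oo[%classic : set R) (fun x => x * fxx x).
  by apply: finite_inL2; [exact: mx|rewrite ltey].
have h1 : inL2 (`[0%R, +oo[%classic : set R) (fun x => x * fx x).
  by apply: finite_inL2; [exact: mx|rewrite ltey].
have h0 : inL2 (`[0%R, +oo[%classic : set R) (fun x => x * f x).
  by apply: finite_inL2; [exact: mx|rewrite ltey].
rewrite /n2 /n1 /n0 (L2normE h2) (L2normE h1) (L2normE h0).
set X2 := Num.sqrt _; set X1 := Num.sqrt _; set X0 := Num.sqrt _.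
rewrite -!EFinD inver gt_eqF// -!EFinM.
set M := (X2 + X1 + X0 + A) / A.
have X1p : 0 <= X1 by rewrite sqrtr_ge0.
have X0p : 0 <= X0 by rewrite sqrtr_ge0.
have X2p : 0 <= X2 by rewrite sqrtr_ge0.
have MA : M * A = X2 + X1 + X0 + A by rewrite /M mulfVK// gt_eqF.
have M1 : 1 <= M by rewrite /M ler_pdivlMr// mul1r; lra.
have [|N [N0 NM hN]] := conc f fx fxx M hH (inL2_L2 h0) (inL2_L2 h1) (inL2_L2 h2) f0 M1.
  by rewrite MA -/X0 -/X2 -/A; lra.
(* half of the constant of laplace_lower_bound, to turn a strict inequality into a contradiction *)
rewrite leNgt; apply/negP => small.
set r := _ * A in small.
have hfL := inL2_L2 hf.
have r0 : 0 < r by rewrite /r !mulr_gt0 ?expR_gt0// invr_gt0.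
have mF := @measurable_laplace R a b f ha hfL.
have := lower f N r hfL N0 (ltW r0) hN.
have nodes s1 s2 : a <= s1 -> s1 < s2 -> s2 <= b ->
      exists2 s, s1 <= s <= s2 & ip (exp_poly s 1) f ^+ 2 * (s2 - s1) <= r ^+ 2.
  move=> as1 s12 s2b; have [s hs hF] := mean_value_node (ltW r0) mF small as1 s12 s2b.
  exists s => //; rewrite -laplace_adjE//.
  by have /andP[h _] := hs; apply: lt_le_trans h; apply: lt_le_trans as1.
move=> /(_ nodes); rewrite -/A leNgt => /negP; apply.
have qN : expR (- (- (k * ln q) * M)) <= q ^+ N.
  rewrite -[q in leRHS](lnK (x := q)) ?posrE// -expRM_natl ler_expR.
  have : 0 <= - ln q by rewrite oppr_ge0 ln_le0// ltW.
  move=> l0; have := ler_wpM2r l0 NM; lra.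
have qN0 : 0 < q ^+ N by rewrite exprn_gt0.
apply: (@le_lt_trans _ _ (c / 2 * q ^+ N * A)).
  by rewrite /r ler_wpM2r ?(ltW A0)// ler_wpM2l// divr_ge0// ltW.
by rewrite ltr_pM2r// ltr_pM2r// ltr_pdivrMr// ltr_pMr// ltr1n.
Qed.
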